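(* Let $E$ be a separable Banach space and let $(X_\alpha)_{\alpha\in\mathcal A}$ be a tight family of Gaussian $E$-valued random variables. Then for every speed function $g$ the family $(g_n^{-1/2}X_\alpha)_n$ is uniformly exponentially tight, i.e., for every $R>0$ there exists a compact set $K_R\subset E$ such that $$\mathbb{P}\bigl(g_n^{-1/2}X_\alpha\notin K_R\bigr)\le e^{-g_nR}$$ for every $\alpha\in\mathcal A$ and for every $n$. In particular, if a sequence $(X_n)_n$ of Gaussian $E$-valued random variables is tight, then for every speed function $g$ the sequence $(g_n^{-1/2}X_n)_n$ is exponentially tight at speed $g$.
   Context: An $E$-valued random variable $Y$ is Gaussian (not necessarily centered) if $\langle\theta,Y\rangle$ is a (possibly degenerate) real Gaussian random variable for every $\theta$ in the topological dual $E'$ of $E$. A speed function is a function $g:\mathbb{N}\to\mathbb{R}^+$, $n\mapsto g_n>0$, such that $\lim_{n\to\infty}g_n=+\infty$. A family $(X_\alpha)_{\alpha\in\mathcal A}$ of $E$-valued random variables is tight if for every $\delta>0$ there exists a compact set $K_\delta\subset E$ such that $\mathbb{P}(X_\alpha\notin K_\delta)<\delta$ for every $\alpha\in\mathcal A$ (and likewise for sequences). A sequence $(Y_n)_n$ of $E$-valued random variables is exponentially tight at speed $g$ if for every $R>0$ there exists a compact set $K_R\subset E$ such that $\mathbb{P}(Y_n\notin K_R)<e^{-g_nR}$ for every $n$. *)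

(* Defs.v *)
From mathcomp Require Import all_boot all_order all_algebra.
From mathcomp Require Import all_classical all_reals all_analysis.

Set Implicit Arguments.
Unset Strict Implicit.
Unset Printing Implicit Defensive.

Import Order.TTheory GRing.Theory Num.Theory.
Import numFieldNormedType.Exports.

Local Open Scope classical_set_scope.
Local Open Scope ring_scope.

Definition separable (T : topologicalType) : Prop :=
  exists2 D : set T, countable D & dense D.

(* [E] seen as a measurable space with its Borel sigma-algebra. *)
Notation borel E := (g_sigma_algebraType (@open E)).

Definition speed_function (R : realType) (g : nat -> R) : Prop :=
  (forall n, 0 < g n) /\ g @ \oo --> +oo.

(* [normal_prob m 0] is the uniform law on [0, 1], by a convention of the
   library, so the degenerate case has to be singled out. *)
Definition gaussian_law (R : realType) (m s : R) (B : set R) : \bar R :=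
  if s == 0 then \d_m B else normal_prob m s B.

Definition real_gaussian (R : realType) (d : measure_display)
    (Omega : measurableType d) (P : probability Omega R) (Z : Omega -> R) : Prop :=
  measurable_fun setT Z /\
  exists m s : R, forall B : set R, measurable B ->
    P (Z @^-1` B) = gaussian_law m s B.

Definition gaussian (R : realType) (E : normedModType R) (d : measure_display)
    (Omega : measurableType d) (P : probability Omega R)
    (Y : {RV P >-> borel E}) : Prop :=
  forall theta : {linear E -> R^o}, continuous theta ->
    real_gaussian P (fun w => theta (Y w)).

Definition tight (R : realType) (E : normedModType R) (d : measure_display)
    (Omega : measurableType d) (P : probability Omega R)
    (A : Type) (X : A -> Omega -> E) : Prop :=
  forall delta : R, 0 < delta ->
    exists2 K : set E, compact K &
      forall a, (P (X a @^-1` (~` K)) < delta%:E)%E.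

Definition exponentially_tight (R : realType) (E : normedModType R)
    (d : measure_display) (Omega : measurableType d) (P : probability Omega R)
    (g : nat -> R) (Y : nat -> Omega -> E) : Prop :=
  forall r : R, 0 < r ->
    exists2 K : set E, compact K &
      forall n, (P (Y n @^-1` (~` K)) < (expR (- (g n * r)))%:E)%E.

Definition uniformly_exponentially_tight (R : realType) (E : normedModType R)
    (d : measure_display) (Omega : measurableType d) (P : probability Omega R)
    (g : nat -> R) (A : Type) (Y : A -> nat -> Omega -> E) : Prop :=
  forall r : R, 0 < r ->
    exists2 K : set E, compact K &
      forall (a : A) (n : nat),
        (P (Y a n @^-1` (~` K)) <= (expR (- (g n * r)))%:E)%E.

(* Main.v *)
From HB Require Import structures.
Require Import Defs.
From mathcomp Require Import all_boot all_order all_algebra.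
From mathcomp Require Import all_classical all_reals all_analysis.
From mathcomp Require Import measurable_realfun ring lra.

Import Order.TTheory GRing.Theory Num.Theory.
Import numFieldNormedType.Exports.

Local Open Scope classical_set_scope.
Local Open Scope ring_scope.

(** Why the theorem holds.

    Fix a compact set [K] that each [X a] leaves with probability at most 1/40.
    By Hahn-Banach and separability there are continuous linear functionals
    [f 0, f 1, ...], bounded by 1 on [K], such that every set
    [polar f t], i.e. {x | |f k x| <= t for all k}, is compact
    ([compact_polar]).  All these sets are dilations of [polar f 1], so the
    theorem reduces to a tail estimate, uniform in [a], for the seminorm
    p x = sup_k |f k x| (with possibly infinite values): it is enough that
    P (p (X a) > t) decreases like exp (- c t^2), with [c] depending only on the
    bound P (p (X a) > 1) <= 1/40.  This is Fernique's theorem.  Dividing [X a]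
    by the square root of [g n] multiplies t^2 by [g n], which is the speed, and
    [g] is bounded below by a positive number, so that one [t] serves for all [n]
    ([gaussian_tail_speed]).

    Fernique's argument requires a centered vector, so [X a] is first replaced
    by the difference U of two independent copies; a tail of U controls a tail
    of [X a] since the other copy stays in [polar f 1] with large
    probability ([gaussian_tail]).  If U' is an independent copy of U,
    then ((U + U') / sqrt 2, (U - U') / sqrt 2) has the law of (U, U').  If the
    first component has p <= s and the second has p > t, then both U and U' have
    p > (t - s) / sqrt 2, whence
      P (p U <= s) P (p U > t) <= P (p U > (t - s) / sqrt 2) ^ 2
    ([fernique_step]).  Iterating along t = s (4 sqrt 2 ^ n - 3) squares the
    ratio P (p U > t) / P (p U <= s) at each step ([fernique]).

    Only the one-dimensional marginals of U are known to be normal, so the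
    invariance under rotation has to be derived from them.  The moment generating
    function of a functional f of U is exp (q t^2), where 2 q is the variance of
    f U, so that q obeys the parallelogram law; hence both pairs give the same
    integral to the exponential of any affine functional ([rotation_law]).
    That these integrals determine the law is proved by a monotone class argument.
    The functions obtained from exponentials of functionals by linear combinations
    and dominated limits ([expspan]) form an algebra, on which the two
    integrals agree.  This algebra contains a functional l, as the limit of
    n (exp (l / n) - 1), hence sin (l / n) by its power series, hence the sign of
    sin (l / n), by the Newton iteration for the sign, and the sign of l by letting
    n tend to infinity.  So it contains the indicators of countable intersections
    of half-spaces ([expspan_indic]), which are all the events used above. *)

Set Implicit Arguments.
Unset Strict Implicit.
Unset Printing Implicit Defensive.

(** * The Hahn-Banach theorem *)

Section HahnBanach.
Context {R : realType} {E : lmodType R}.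
Implicit Types (p q : E -> R) (x y : E).

Definition sublinear p : Prop :=
  (forall x y, p (x + y) <= p x + p y) /\
  (forall (a : R) x, 0 <= a -> p (a *: x) <= a * p x).

Lemma sublinear_ge0 p x : sublinear p -> 0 <= p x + p (- x).
Proof.
move=> [pD pZ]; apply: le_trans (pD _ _); rewrite subrr.
by have := pD 0 0; rewrite addr0; lra.
Qed.

(** The largest sublinear functional below [q] that is at most [- q y] at [- y]:
    decreasing [q] in this way makes it linear along [y]. *)
Definition tilt q y x : R := inf [set q (x + t *: y) - t * q y | t in [set t | 0 <= t]].

Lemma tilt_le q y x t : sublinear q -> 0 <= t ->
  tilt q y x <= q (x + t *: y) - t * q y.
Proof.
move=> sq t0; apply: ge_inf; last by exists t.
exists (- q (- x)) => _ [u /= u0 <-].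
have [qD qZ] := sq.
have := qD (x + u *: y) (- x); rewrite addrAC subrr add0r.
have [->|une] := eqVneq u 0.
  by rewrite scale0r mul0r; have := sublinear_ge0 0 sq; rewrite oppr0; lra.
have := qZ u^-1 (u *: y); rewrite invr_ge0 => /(_ u0).
rewrite scalerA mulVf// scale1r ler_pdivlMl ?lt_def ?une//; lra.
Qed.

Lemma le_tilt q y x (c : R) :
  (forall t, 0 <= t -> c <= q (x + t *: y) - t * q y) -> c <= tilt q y x.
Proof.
move=> h; apply: lb_le_inf.
  by exists (q (x + 0 *: y) - 0 * q y); exists 0 => /=.
by move=> _ [t /= t0 <-]; exact: h.
Qed.

Lemma tilt_le_id q y x : sublinear q -> tilt q y x <= q x.
Proof.
by move=> sq; have := tilt_le y x sq (lexx 0); rewrite scale0r addr0 mul0r subr0.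
Qed.

Lemma tiltN q y : sublinear q -> tilt q y (- y) <= - q y.
Proof.
move=> sq; have := tilt_le y (- y) sq ler01; rewrite scale1r addNr mul1r.
have [_ /(_ 0 0 (lexx 0))] := sq; rewrite scale0r mul0r; lra.
Qed.

Lemma sublinear_tilt q y : sublinear q -> sublinear (tilt q y).
Proof.
move=> sq; have [qD qZ] := sq; split=> [x1 x2|a x a0].
  rewrite -lerBlDl; apply: le_tilt => t t0.
  rewrite lerBlDl -lerBlDr; apply: le_tilt => u u0.
  have := tilt_le y (x1 + x2) sq (addr_ge0 u0 t0).
  rewrite scalerDl addrACA.
  have := qD (x1 + u *: y) (x2 + t *: y); lra.
have [->|ane] := eqVneq a 0.
  rewrite scale0r mul0r; apply: le_trans (tilt_le_id _ _ sq) _.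
  by have := qZ 0 0 (lexx 0); rewrite scale0r mul0r.
have ap : 0 < a by rewrite lt_def ane.
rewrite -ler_pdivrMl//; apply: le_tilt => t t0; rewrite ler_pdivrMl//.
apply: le_trans (tilt_le y _ sq (mulr_ge0 a0 t0)) _.
have := qZ a (x + t *: y) a0; rewrite scalerDr scalerA; lra.
Qed.

(** Zorn's lemma: the pointwise infimum of a chain of sublinear functionals is
    sublinear, and it is finite because [- p (- x)] bounds the chain below at [x]. *)
Lemma minimal_sublinear p : sublinear p ->
  exists q, [/\ sublinear q, forall x, q x <= p x &
   forall r, sublinear r -> (forall x, r x <= q x) -> r = q].
Proof.
move=> sp.
pose T := {q : E -> R | sublinear q /\ forall x, q x <= p x}.
pose le (q1 q2 : T) := `[< forall x, sval q2 x <= sval q1 x >].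
have [|||A totA|q qmin] := @Zorn T le.
- by move=> q; apply/asboolP.
- move=> q1 q2 q3 /asboolP h1 /asboolP h2; apply/asboolP => x.
  exact: le_trans (h2 x) (h1 x).
- move=> [q1 H1] [q2 H2] /asboolP /= h1 /asboolP /= h2; apply: eq_exist.
  by apply/funext => x; apply/eqP; rewrite eq_le h1 h2.
- have [[q0 Aq0]|A0] := pselect (exists q : T, A q); last first.
    by exists (exist _ p (conj sp (fun=> lexx _))) => s As; case: A0; exists s.
  pose S x := [set sval q x | q in A].
  pose m x := inf (S x).
  have Sinf (q : T) x : A q -> m x <= sval q x.
    move=> Aq; apply: ge_inf; last by exists q.
    exists (- p (- x)) => _ [r Ar <-].
    case: r Ar => r [sr rp] _ /=; have := sublinear_ge0 x sr.
    have := rp (- x); lra.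
  have leinf c x : (forall q : T, A q -> c <= sval q x) -> c <= m x.
    move=> h; apply: lb_le_inf; first by exists (sval q0 x); exists q0.
    by move=> _ [q Aq <-]; exact: h.
  have sm : sublinear m.
    split=> [x y|a x a0].
      rewrite -lerBlDl; apply: (leinf) => q2 Aq2.
      rewrite lerBlDl -lerBlDr; apply: (leinf) => q1 Aq1.
      (* two members of the chain have a common lower member *)
      have [q [Aq qq1 qq2]] : exists q : T, [/\ A q, sval q x <= sval q1 x
          & sval q y <= sval q2 y].
        by have [/asboolP h|/asboolP h] := totA _ _ Aq1 Aq2;
          [exists q2|exists q1].
      rewrite lerBlDr; apply: le_trans (Sinf _ _ Aq) _.
      have [[qD _] _] := svalP q; have := qD x y; lra.
    have [->|ane] := eqVneq a 0.
      rewrite scale0r mul0r; apply: le_trans (Sinf _ _ Aq0) _.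
      have [[_ /(_ 0 0 (lexx 0)) q0Z] _] := svalP q0; move: q0Z.
      by rewrite scale0r mul0r.
    have ap : 0 < a by rewrite lt_def ane.
    rewrite -ler_pdivrMl//; apply: (leinf) => q Aq; rewrite ler_pdivrMl//.
    apply: le_trans (Sinf _ _ Aq) _.
    by have [[_ qZ] _] := svalP q; exact: qZ.
  have mp x : m x <= p x.
    by apply: le_trans (Sinf _ _ Aq0) _; have [_] := svalP q0.
  exists (exist _ m (conj sm mp)) => s As; apply/asboolP => x /=.
  exact: Sinf.
exists (sval q); have [sq qp] := svalP q; split=> // r sr rq.
have rp x : r x <= p x by exact: le_trans (rq x) (qp x).
by have := qmin (exist _ r (conj sr rp)); rewrite /le => <- //; apply/asboolP.
Qed.

(** A minimal sublinear functional coincides with all its tilts, so it is odd, and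
    an odd sublinear functional is linear.  Minimising below the tilt of [p] along
    [x0], rather than below [p], forces the value [p x0] at [x0]. *)
Lemma hahn_banach p x0 : sublinear p ->
  exists f : {linear E -> R^o}, (forall x, f x <= p x) /\ f x0 = p x0.
Proof.
move=> sp; have [q [sq qt qmin]] := minimal_sublinear (sublinear_tilt x0 sp).
have qN y : q (- y) = - q y.
  have : tilt q y = q.
    by apply: qmin; [exact: sublinear_tilt|move=> x; exact: tilt_le_id].
  move=> /(congr1 (fun f => f (- y))); have := tiltN y sq.
  have := sublinear_ge0 y sq; lra.
have [qD qZ] := sq.
have qZ0 a x : 0 <= a -> q (a *: x) = a * q x.
  move=> a0; have := qZ a x a0; have := qZ a (- x) a0.
  rewrite scalerN !qN; lra.
have qlin : GRing.linear_for *%R (q : E -> R^o).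
  move=> a x y.
  have -> : q (a *: x + y) = q (a *: x) + q y.
    have := qD (a *: x) y; have := qD (- (a *: x)) (- y).
    rewrite -opprD !qN; lra.
  congr (_ + _); have [a0|a0] := leP 0 a; first exact: qZ0.
  have : q (- a *: x) = - a * q x by apply: qZ0; lra.
  rewrite scaleNr qN; lra.
pose qL := GRing.isLinear.Build R E R^o *%R (q : E -> R^o) qlin.
pose f : {linear E -> R^o} := HB.pack (q : E -> R^o) qL.
exists f; split=> [x|]; first exact: le_trans (qt x) (tilt_le_id _ _ sp).
apply/eqP; rewrite eq_le; apply/andP; split.
  exact: le_trans (qt x0) (tilt_le_id _ _ sp).
have := le_trans (qt (- x0)) (tiltN x0 sp); rewrite qN /=.
by rewrite lerNl opprK.
Qed.

End HahnBanach.

(** * Compact absolutely convex sets cut out by countably many functionals *)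

(** Given an ultrafilter on [K], its image on a nearby compact set [H] under an
    approximate projection clusters at some point, whose ball then belongs to the
    ultrafilter up to the error [e]; so the ultrafilter is Cauchy. *)
Lemma near_compact_compact (R : realType) (E : completeNormedModType R)
    (K : set E) : closed K ->
  (forall e : R, 0 < e -> exists2 H : set E, compact H &
     forall x, K x -> exists2 h, H h & `|x - h| < e) ->
  compact K.
Proof.
move=> clK netK; rewrite compact_ultra => F FU FK.
have PF : ProperFilter F by exact: ultra_proper.
have cF : cauchy_ex F.
  move=> e e0; have e20 : 0 < e / 2 by lra.
  have [H cH HK] := netK (e / 2) e20.
  have /choice[h hP] : forall x, exists h, K x -> H h /\ `|x - h| < e / 2.
    move=> x; have [/HK[h]|] := pselect (K x); first by exists h.
    by exists x.
  have [|y [Hy cly]] := cH (h @ F) _.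
    by rewrite /= nbhs_simpl; apply: (filterS _ FK) => x /hP[].
  exists y; have [|FC] := in_ultra_setVsetC (h @^-1` ball y (e / 2)) FU.
    move=> Fh; apply: (filterS _ (filterI FK Fh)) => x [/hP[_ xh]].
    rewrite -!ball_normE /= => yh.
    have := ler_distD (h x) y x; rewrite (distrC (h x) x); lra.
  have [z [/= nz]] := cly (~` ball y (e / 2)) (ball y (e / 2)) FC (nbhsx_ballx _ _ e20).
  by [].
have /cvg_ex[l Fl] : cvg F by apply/cauchy_cvgP/cauchy_exP.
exists l; split=> //; apply: (@closed_cvg _ _ F _ id K clK _ l Fl).
exact: FK.
Qed.

Lemma separable_dense_seq (R : realType) (E : normedModType R) : separable E ->
  exists u : nat -> E, forall x (e : R), 0 < e -> exists i, `|x - u i| < e.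
Proof.
move=> [D cD dD].
have [u uD] : exists u : nat -> E, D `<=` range u.
  by have /pcard_surjP[u us] := cD; exists u.
exists u => x e e0.
have [|y [xy /uD[i _ iy]]] := dD (ball x e) _ (ball_open x e).
  by exists x; exact: ballxx.
by exists i; move: xy; rewrite -ball_normE /= iy.
Qed.

(** A seminorm that the norm dominates is the supremum of countably many
    functionals: at each point of a dense sequence take a functional below [p] that
    equals [p] there; continuity of [p] does the rest. *)
Lemma sublinear_sup (R : realType) (E : normedModType R) (p : E -> R) (c : R) :
  separable E -> sublinear p -> (forall x, p (- x) <= p x) ->
  (forall x, p x <= c * `|x|) ->
  exists f : nat -> {linear E -> R^o}, [/\ forall i, continuous (f i : E -> R),
    forall i x, `|f i x : R| <= p x &
    forall x t, (forall i, `|f i x : R| <= t) -> p x <= t].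
Proof.
move=> sE sp pN pc; have [u du] := separable_dense_seq sE.
have [f fP] := choice (fun i => hahn_banach (u i) sp).
have fp i x : `|f i x : R| <= p x.
  rewrite ler_norml; have [h _] := fP i; rewrite h andbT.
  by rewrite lerNl -linearN; exact: le_trans (h _) (pN x).
exists f; split=> [i|//|x t xt].
- apply/linear_bounded_continuous/linear_boundedP; near=> r => x.
  apply: le_trans (fp i x) _; apply: le_trans (pc x) _.
  by apply: ler_wpM2r => //; near: r; apply: nbhs_pinfty_ge; exact: num_real.
apply/ler_addgt0Pr => e e0.
have c0 : 0 < `|c| + 1 by have := normr_ge0 c; lra.
have [i xi] := du x (e / (2 * (`|c| + 1))) (divr_gt0 e0 (mulr_gt0 (ltr0Sn _ 1) c0)).
have [sD _] := sp.
have px : p x <= p (u i) + p (x - u i) by rewrite addrC -[in leLHS](subrK (u i) x) sD.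
have [fi fui] := fP i.
have pxi : p (x - u i) <= e / 2.
  apply: le_trans (pc _) _.
  apply: (@le_trans _ _ ((`|c| + 1) * `|x - u i|)).
    by apply: ler_wpM2r => //; have := ler_norm c; lra.
  by rewrite -ler_pdivlMl// mulrC -mulrA -invfM ltW.
have : p (u i) <= t + p (x - u i).
  rewrite -fui -[in leLHS](subrK x (u i)) linearD /= addrC lerD//.
    by apply: le_trans (xt i); exact: ler_norm.
  by apply: le_trans (fi _) _; rewrite -opprB.
lra.
Unshelve. all: by end_near. Qed.

Section Gauge.
Context {R : realType} {E : normedModType R} (s : seq E) (e : R).
Hypothesis e0 : 0 < e.

Definition lincomb (v : 'rV[R]_(size s)) : E := \sum_(i < size s) v ord0 i *: s`_i.

Lemma lincombD u v : lincomb (u + v) = lincomb u + lincomb v.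
Proof.
by rewrite /lincomb -big_split; apply: eq_bigr => i _; rewrite mxE scalerDl.
Qed.

Lemma lincombZ a v : lincomb (a *: v) = a *: lincomb v.
Proof.
by rewrite /lincomb scaler_sumr; apply: eq_bigr => i _; rewrite mxE scalerA.
Qed.

Lemma lincomb0 : lincomb 0 = 0.
Proof. by have := lincombZ 0 0; rewrite !scale0r. Qed.

Lemma continuous_lincomb : continuous lincomb.
Proof.
apply: continuous_big => [|i _ v].
  by move=> x; exact: add_continuous.
apply: cvgZr_tmp; first exact: (nbhs_filter v).
exact: (@coord_continuous R 1 (size s) ord0 i v).
Qed.

(** Up to a factor between 1 and 2, the gauge of the sum of the ball of radius [e]
    and of the absolutely convex box spanned by the points of [s].  The penalty on the
    coefficients makes the sublevel sets close to a compact set, although the span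
    of [s] itself is unbounded. *)
Definition gauge (x : E) : R :=
  inf [set (`|v| + `|x - lincomb v| / e) / 2 | v in [set: 'rV[R]_(size s)]].

Lemma gauge_le x v : gauge x <= (`|v| + `|x - lincomb v| / e) / 2.
Proof.
apply: ge_inf; last by exists v.
exists 0 => _ [u _ <-]; rewrite divr_ge0 ?addr_ge0// divr_ge0//; exact: ltW.
Qed.

Lemma le_gauge x c : (forall v, c <= (`|v| + `|x - lincomb v| / e) / 2) -> c <= gauge x.
Proof.
move=> h; apply: lb_le_inf; last by move=> _ [v _ <-].
by exists ((`|0 : 'rV[R]_(size s)| + `|x - lincomb 0| / e) / 2); exists 0.
Qed.

Lemma gauge_lt x c : gauge x < c ->
  exists2 v, `|v| < 2 * c & `|x - lincomb v| < 2 * c * e.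
Proof.
move=> gx; have [|_ [v _ <-] vc] := inf_lt _ gx.
  by exists ((`|0 : 'rV[R]_(size s)| + `|x - lincomb 0| / e) / 2); exists 0.
exists v; first by have := divr_ge0 (normr_ge0 (x - lincomb v)) (ltW e0); lra.
by rewrite -ltr_pdivrMr//; have := normr_ge0 v; lra.
Qed.

Lemma sublinear_gauge : sublinear gauge.
Proof.
split=> [x y|a x a0].
  rewrite -lerBlDl; apply: le_gauge => v.
  rewrite lerBlDl -lerBlDr; apply: le_gauge => u; rewrite lerBlDr.
  apply: le_trans (gauge_le _ (u + v)) _.
  rewrite lincombD opprD addrACA -mulrDl ler_pM2r// [leRHS]addrACA lerD ?ler_normD//.
  by rewrite -mulrDl ler_pM2r ?invr_gt0// ler_normD.
have [->|ane] := eqVneq a 0.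
  rewrite scale0r mul0r; apply: le_trans (gauge_le _ 0) _.
  by rewrite lincomb0 subr0 !normr0 mul0r addr0 mul0r.
have ap : 0 < a by rewrite lt_def ane.
rewrite -ler_pdivrMl//; apply: le_gauge => v; rewrite ler_pdivrMl//.
apply: le_trans (gauge_le _ (a *: v)) _.
by rewrite lincombZ -scalerBr !normrZ (ger0_norm a0) -mulrA -mulrDr mulrA.
Qed.

Lemma gaugeN x : gauge (- x) <= gauge x.
Proof.
apply: le_gauge => v; apply: le_trans (gauge_le _ (- v)) _.
by rewrite -[- v]scaleN1r lincombZ !scaleN1r -opprD normrN normrN.
Qed.

Lemma gauge_norm x : gauge x <= (2 * e)^-1 * `|x|.
Proof.
apply: le_trans (gauge_le _ 0) _.
rewrite lincomb0 subr0 normr0 add0r invfM.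
by rewrite mulrC [`|x| / e]mulrC mulrA.
Qed.

Lemma gauge_le1 x : (exists2 y, y \in s & `|x - y| < e) -> gauge x <= 1.
Proof.
move=> [y ys xy]; have ysz : (index y s < size s)%N by rewrite index_mem.
pose v : 'rV[R]_(size s) := delta_mx ord0 (Ordinal ysz).
apply: le_trans (gauge_le _ v) _.
have -> : lincomb v = y.
  rewrite /lincomb (bigD1 (Ordinal ysz))//= mxE !eqxx scale1r nth_index//.
  rewrite big1 ?addr0// => i ine; rewrite mxE eqxx /= (negbTE ine).
  by rewrite scale0r.
have : `|v| <= 1.
  rewrite [leLHS]/Num.norm /= mx_normrE; apply/bigmax_leP.
  split=> // -[i j] _ /=; rewrite mxE.
  by case: (_ && _); rewrite ?normr1 ?normr0.
have : `|x - y| / e <= 1 by rewrite ler_pdivrMr// mul1r ltW.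
lra.
Qed.

End Gauge.

Lemma compact_net (R : realType) (E : normedModType R) (K : set E) (e : R) :
  compact K -> 0 < e ->
  exists s : seq E, forall x, K x -> exists2 y, y \in s & `|x - y| < e.
Proof.
move=> cK e0; move: cK; rewrite compact_cover => /(_ E setT (fun y => ball y e)).
case=> [y _|x Kx|D _ KD]; first exact: ball_open.
  by exists x => //; exact: ballxx.
exists (finmap.enum_fset D) => x /KD[y yD yx]; exists y => //.
by rewrite distrC; move: yx; rewrite -ball_normE.
Qed.

(** For each [e j] take a finite [e j]-net [s j] of [K] and functionals whose supremum
    is the gauge of [s j] and [e j].  Then a point of the polar set is within
    a multiple of [e j] of the image of a box under [lincomb], which is compact. *)
Lemma compact_polar (R : realType) (E : completeNormedModType R) (K : set E) :
  separable E -> compact K ->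
  exists f : nat -> {linear E -> R^o}, [/\ forall k, continuous (f k : E -> R),
    forall x, K x -> forall k, `|f k x : R| <= 1 &
    forall t : R, compact [set x | forall k, `|f k x : R| <= t]].
Proof.
move=> sE cK; pose e (j : nat) : R := j.+1%:R^-1.
have e0 j : 0 < e j by rewrite invr_gt0.
have /choice[s sP] := fun j => compact_net cK (e0 j).
have [F FP] := choice (fun j => sublinear_sup sE (sublinear_gauge (s j) (e0 j))
   (@gaugeN _ _ (s j) _ (e0 j)) (@gauge_norm _ _ (s j) _ (e0 j))).
pose f k := if unpickle k is Some (j, i) then F j i else F 0%N 0%N.
have fF j i : f (pickle (j, i)) = F j i by rewrite /f pickleK.
have fP (Q : {linear E -> R^o} -> Prop) : (forall j i, Q (F j i)) -> forall k, Q (f k).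
  by move=> h k; rewrite /f; case: unpickle => [[]|].
exists f; split.
- by apply: (fP (fun g => continuous (g : E -> R))) => j i; have [] := FP j.
- move=> x Kx; apply: (fP (fun g => `|g x : R| <= 1)) => j i; have [_ h _] := FP j.
  by apply: le_trans (h i x) _; apply: gauge_le1 => //; exact: sP.
move=> t; apply: near_compact_compact.
  rewrite (_ : [set _ | _] = \bigcap_k [set x | `|f k x : R| <= t]); last first.
    by apply/seteqP; split=> [x h k _|x h k]; [exact: h|exact: (h k I)].
  apply: closed_bigI => k _.
  apply: (@preimage_closed _ _ (fun x => `|f k x : R|) _ _ (@closed_le _ t)) => x _.
  apply: continuous_comp; last exact: norm_continuous.
  by apply: (fP (fun g => continuous (g : E -> R))) => j i; have [] := FP j.
move=> d d0; set c := `|t| + 1.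
have c0 : 0 < c by rewrite /c; have := normr_ge0 t; lra.
have [j jP] : exists j, 2 * c * e j <= d.
  exists (Num.truncn (2 * c / d)).
  by rewrite /e ler_pdivrMr// [d * _]mulrC -ler_pdivrMr// ltW// truncnS_gt.
exists (@lincomb _ _ (s j) @`
    [set v : 'rV[R]_(size (s j)) | forall i, `[- (2 * c), 2 * c]%classic (v ord0 i)]).
  apply: continuous_compact; first exact/continuous_subspaceT/continuous_lincomb.
  by apply: (@rV_compact R _ (fun=> `[- (2 * c), 2 * c]%classic)) => i; exact: segment_compact.
move=> x xt.
have gx : gauge (s j) (e j) x < c.
  apply: (@le_lt_trans _ _ t); last by rewrite /c; have := ler_norm t; lra.
  by have [_ _ h] := FP j; apply: h => i; rewrite -fF.
have [v vc xv] := gauge_lt (e0 j) gx.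
exists (lincomb v); last exact: lt_le_trans xv jP.
exists v => //= i; rewrite in_itv /= -ler_norml; apply: le_trans (ltW vc).
by rewrite [leRHS]/Num.norm /= mx_normrE; apply/bigmax_geP; right; exists (ord0, i).
Qed.

(** * Functions determined by exponential integrals *)

Section ExpLimits.
Context {R : realType}.
Implicit Types x y : R.

Lemma expRB1_bounds y (n : nat) :
  y <= n.+1%:R * (expR (y / n.+1%:R) - 1) <= y * expR (y / n.+1%:R).
Proof.
have n0 : 0 < n.+1%:R :> R by [].
set u := y / n.+1%:R; have yu : y = n.+1%:R * u by rewrite /u mulrC divfK// gt_eqF.
rewrite {1 2}yu -mulrA !ler_pM2l//; apply/andP; split.
  by have := expR_ge1Dx u; lra.
have := expR_ge1Dx (- u); have := expR_gt0 u; rewrite expRN => u0 h.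
have : (1 - u) * expR u <= (expR u)^-1 * expR u by rewrite ler_wpM2r// ltW.
by rewrite mulVf ?gt_eqF//; lra.
Qed.

Lemma cvg_divSn y : y / n.+1%:R @[n --> \oo] --> 0.
Proof. by rewrite -(mulr0 y); apply: cvgM; [exact: cvg_cst|exact: cvg_harmonic]. Qed.

Lemma cvg_expRB1 y : n.+1%:R * (expR (y / n.+1%:R) - 1) @[n --> \oo] --> y.
Proof.
apply: (@squeeze_cvgr _ _ _ _ (fun=> y) (fun n => y * expR (y / n.+1%:R))).
- by apply: nearW => n; exact: expRB1_bounds.
- exact: cvg_cst.
- have h : expR (y / n.+1%:R) @[n --> \oo] --> expR 0.
    by apply: continuous_cvg; [exact: continuous_expR|exact: cvg_divSn].
  rewrite expR0 in h; rewrite -[X in _ --> X]mulr1.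
  by apply: cvgM => //; exact: cvg_cst.
Qed.

(** The bound has to be uniform in [n] and of exponential type, in order to be
    integrable against the laws considered below. *)
Lemma expRB1_dominated y n :
  `|n.+1%:R * (expR (y / n.+1%:R) - 1)| <= expR `|2 * y|.
Proof.
have n1 : (1 : R) <= n.+1%:R by rewrite ler1n.
have yn : y / n.+1%:R <= `|y|.
  apply: le_trans (ler_norm _) _; rewrite normrM normfV (ger0_norm (le_trans ler01 n1)).
  by rewrite ler_pdivrMr ?(lt_le_trans ltr01)// ler_peMr.
have /andP[lo hi] := expRB1_bounds y n.
have ey : 1 <= expR `|y| by rewrite -expR0 ler_expR.
have ly : `|y| <= expR `|y| by have := expR_ge1Dx `|y|; lra.
have hy : y * expR (y / n.+1%:R) <= `|y| * expR `|y|.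
  apply: le_trans (ler_norm _) _; rewrite normrM (ger0_norm (expR_ge0 _)).
  by rewrite ler_wpM2l// ler_expR.
have e2 : expR `|2 * y| = expR `|y| * expR `|y|.
  by rewrite normrM ger0_norm// mulr2n mulrDl mul1r expRD.
have h2 : `|y| * expR `|y| <= expR `|2 * y| by rewrite e2 ler_wpM2r// expR_ge0.
have h3 : `|y| <= expR `|2 * y|.
  by rewrite e2; apply: le_trans ly _; rewrite ler_peMr// expR_ge0.
rewrite ler_norml; have := ler_norm (- y); rewrite normrN; lra.
Qed.

Lemma series_sin_coeff_dominated y n : `|series (sin_coeff y) n| <= expR `|y|.
Proof.
apply: (@le_trans _ _ (series (exp_coeff `|y|) n)).
  apply: le_trans (ler_norm_sum _ _ _) _; apply: ler_sum => i _.
  rewrite /exp_coeff /sin_coeff /=.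
  rewrite !normrM normfV !normr_nat !normrX normrN normr1 expr1n mulr1.
  by rewrite -mulrA ler_piMl// ?lern1 ?leq_b1// divr_ge0.
apply: nondecreasing_cvgn_le; last exact: is_cvg_series_exp_coeff.
by apply/nondecreasing_seqP => k; rewrite /series /= big_nat_recr//= lerDl exp_coeff_ge0.
Qed.

Lemma cvg_series_sin y : series (sin_coeff y) n @[n --> \oo] --> sin y.
Proof. by rewrite unlock; exact: is_cvg_series_sin_coeff. Qed.

(** Newton's iteration for the equation s^2 = 1, without division: it is
    polynomial in the starting value, so it stays within an algebra of functions,
    and on [-1, 1] it converges to the sign, with 0 as a fixed point. *)
Fixpoint newton_sgn (n : nat) (y : R) : R :=
  if n is k.+1 then newton_sgn k y * (3 - newton_sgn k y ^+ 2) / 2 else y.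

Lemma newton_sgnN n y : newton_sgn n (- y) = - newton_sgn n y.
Proof. by elim: n => //= n ->; rewrite sqrrN !mulNr. Qed.

Lemma newton_sgn_bounds n y : 0 <= y <= 1 ->
  0 <= newton_sgn n y <= 1 /\ 1 - newton_sgn n y <= (1 - y / 2) ^+ n.
Proof.
move=> /andP[y0 y1].
suff : y <= newton_sgn n y <= 1 /\ 1 - newton_sgn n y <= (1 - y / 2) ^+ n.
  by move=> [/andP[yn -> ->]]; rewrite (le_trans y0 yn).
elim: n => [|n [/andP[yn n1] IH]] /=; first by rewrite expr0; split; lra.
set s := newton_sgn n y in yn n1 IH *.
have E : 1 - s * (3 - s ^+ 2) / 2 = (1 - s) * ((1 - s) * (2 + s) / 2) by field.
have s0 : 0 <= s by lra.
have s1 : 0 <= 1 - s by lra.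
have s2 : 0 <= s ^+ 2 by exact: sqr_ge0.
have F0 : 0 <= (1 - s) * (2 + s) / 2 by apply: divr_ge0 => //; apply: mulr_ge0; lra.
split.
  have h1 : 0 <= s * ((1 - s) * (1 + s)) by rewrite !mulr_ge0//; lra.
  have h2 := mulr_ge0 s1 F0; rewrite -E in h2.
  apply/andP; split; last by lra.
  have -> : s * (3 - s ^+ 2) / 2 = s + s * ((1 - s) * (1 + s)) / 2 by field.
  lra.
rewrite E mulrC exprS; apply: ler_pM => //.
have -> : (1 - s) * (2 + s) / 2 = 1 - s / 2 - s ^+ 2 / 2 by field.
lra.
Qed.

Lemma newton_sgn_le1 n y : `|y| <= 1 -> `|newton_sgn n y| <= 1.
Proof.
wlog y0 : y / 0 <= y.
  move=> h; have [/h//|y0] := leP 0 y; rewrite -normrN -(normrN (newton_sgn _ _)).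
  by rewrite -newton_sgnN; apply: h; lra.
rewrite ger0_norm// => y1.
have [|/andP[a b] _] := @newton_sgn_bounds n y; first by rewrite y0.
by rewrite ger0_norm.
Qed.

Lemma cvg_newton_sgn y : `|y| <= 1 -> newton_sgn n y @[n --> \oo] --> Num.sg y.
Proof.
wlog y0 : y / 0 <= y.
  move=> h; have [/h//|y0] := leP 0 y; rewrite -normrN => y1.
  rewrite -[y]opprK sgrN; under eq_fun do rewrite newton_sgnN.
  by apply: cvgN; apply: h => //; lra.
rewrite ger0_norm// => y1; move: y0; rewrite le_eqVlt => /orP[/eqP <-|y0].
  rewrite sgr0 (_ : (fun _ => _) = fun=> 0); first exact: cvg_cst.
  by apply/funext; elim=> //= n ->; rewrite !mul0r.
rewrite gtr0_sg//.
have B n := @newton_sgn_bounds n y (introT andP (conj (ltW y0) y1)).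
apply: (@squeeze_cvgr _ _ _ _ (fun n => 1 - (1 - y / 2) ^+ n) (fun=> 1)).
- by apply: nearW => n; have [/andP[_ ->] ?] := B n; rewrite andbT; lra.
- rewrite -[X in _ --> X]subr0; apply: cvgB; first exact: cvg_cst.
  by apply: cvg_expr; rewrite ger0_norm; lra.
- exact: cvg_cst.
Qed.

Lemma cvg_sgn_sin y : Num.sg (sin (y / n.+1%:R)) @[n --> \oo] --> Num.sg y.
Proof.
wlog y0 : y / 0 <= y.
  move=> h; have [/h//|y0] := leP 0 y.
  rewrite -[y]opprK sgrN; under eq_fun do rewrite mulNr sinN sgrN.
  by apply: cvgN; apply: h => //; lra.
move: y0; rewrite le_eqVlt => /orP[/eqP <-|y0].
  by rewrite sgr0; under eq_fun do rewrite mul0r sin0 sgr0; exact: cvg_cst.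
rewrite gtr0_sg//; apply: cvg_near_cst.
near=> n; rewrite gtr0_sg// sin_gt0_pi//; apply/andP; split; first exact: divr_gt0.
rewrite ltr_pdivrMr//; apply: (@lt_le_trans _ _ (1 * n.+1%:R)); last first.
  by rewrite ler_pM2r//; have := @pi_ge2 R; lra.
rewrite mul1r; near: n; exists (Num.truncn y) => // n /= yn.
by apply: lt_le_trans (truncnS_gt _) _; rewrite ler_nat.
Unshelve. all: by end_near. Qed.

End ExpLimits.

Section ExpSpan.
Context {R : realType} {T : Type} (L : set (T -> R)).
Hypothesis Llin : forall a b l m, L l -> L m -> L (fun x => a * l x + b * m x).
Hypothesis Lcst : forall c, L (fun=> c).

(** The smallest class that contains the exponentials of [L] and is stable under
    linear combinations and dominated pointwise limits.  The dominating function is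
    in the class too: thus two measures that give the same finite integrals to the
    exponentials give the same finite integrals to all its members. *)
Inductive expspan : (T -> R) -> Prop :=
| expspan_exp l : L l -> expspan (fun x => expR (l x))
| expspan_lin a f g : expspan f -> expspan g -> expspan (fun x => a * f x + g x)
| expspan_lim f_ f D : (forall n, expspan (f_ n)) -> expspan D ->
    (forall n x, `|f_ n x| <= D x) -> (forall x, f_ n x @[n --> \oo] --> f x) ->
    expspan f.

Lemma expspan_ext f g : f =1 g -> expspan f -> expspan g.
Proof. by move=> /funext ->. Qed.

Lemma expspan_cst c : expspan (fun=> c).
Proof.
have e1 : expspan (fun=> 1).
  by apply: (expspan_ext _ (expspan_exp (Lcst 0))) => x; rewrite expR0.
by apply: (expspan_ext _ (expspan_lin (c - 1) e1 e1)) => x; rewrite mulr1 subrK.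
Qed.

Lemma expspanZ a f : expspan f -> expspan (fun x => a * f x).
Proof.
move=> ef; apply: (expspan_ext _ (expspan_lin a ef (expspan_cst 0))) => x.
by rewrite addr0.
Qed.

Lemma expspanD f g : expspan f -> expspan g -> expspan (fun x => f x + g x).
Proof.
by move=> ef eg; apply: (expspan_ext _ (expspan_lin 1 ef eg)) => x; rewrite mul1r.
Qed.

Lemma expspan_dominated f : expspan f ->
  exists2 D, expspan D & forall x, `|f x| <= D x.
Proof.
elim=> {f} [l Ll|a f g _ [Df eDf fD] _ [Dg eDg gD]|f_ f D ef IHf eD _ fD ff].
- exists (fun x => expR (l x)); first exact: expspan_exp.
  by move=> x; rewrite ger0_norm ?expR_ge0.
- exists (fun x => `|a| * Df x + Dg x); first exact: expspan_lin.
  move=> x; apply: le_trans (ler_normD _ _) _.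
  by rewrite normrM lerD// ler_wpM2l.
- exists D => // x; have h : `|f_ n x| @[n --> \oo] --> `|f x| by apply: cvg_norm; exact: ff.
  by apply: (cvgr_to_le h); apply: nearW => n; exact: fD.
Qed.

(** Products of exponentials are exponentials since [L] is stable under sums; limits
    are dealt with one factor at a time, which is why a dominating function is needed
    for the other factor. *)
Lemma expspanM f g : expspan f -> expspan g -> expspan (fun x => f x * g x).
Proof.
move=> ef; elim: ef g => {f} [l Ll|a f1 f2 _ IH1 _ IH2|f_ f D _ IHf _ IHD fD ff] g.
- elim=> {g} [m Lm|b g1 g2 _ IH1 _ IH2|g_ g D _ IHg _ IHD gD gg].
  + apply: (expspan_ext _ (expspan_exp (Llin 1 1 Ll Lm))) => x.
    by rewrite !mul1r expRD.
  + apply: (expspan_ext _ (expspan_lin b IH1 IH2)) => x; ring.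
  + apply: (expspan_lim IHg IHD) => [n x|x].
      by rewrite normrM ger0_norm ?expR_ge0// ler_wpM2l// expR_ge0.
    by apply: cvgM; [exact: cvg_cst|exact: gg].
- move=> eg; apply: (expspan_ext _ (expspan_lin a (IH1 _ eg) (IH2 _ eg))) => x.
  ring.
- move=> eg; have [Dg eDg gD] := expspan_dominated eg.
  apply: (expspan_lim (fun n => IHf n _ eg) (IHD _ eDg)) => [n x|x].
    by rewrite normrM ler_pM.
  by apply: cvgM; [exact: ff|exact: cvg_cst].
Qed.

Lemma expspanX f n : expspan f -> expspan (fun x => f x ^+ n).
Proof.
move=> ef; elim: n => [|n IH]; first exact: (expspan_cst 1).
by apply: (expspan_ext _ (expspanM ef IH)) => x; rewrite exprS.
Qed.

Lemma expspan_sum (f_ : nat -> T -> R) n :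
  (forall i, expspan (f_ i)) -> expspan (fun x => \sum_(0 <= i < n) f_ i x).
Proof.
move=> ef; elim: n => [|n IH].
  by apply: (expspan_ext _ (expspan_cst 0)) => x; rewrite big_nil.
by apply: (expspan_ext _ (expspanD IH (ef n))) => x; rewrite big_nat_recr.
Qed.

Lemma expspan_prod (f_ : nat -> T -> R) n :
  (forall i, expspan (f_ i)) -> expspan (fun x => \prod_(0 <= i < n) f_ i x).
Proof.
move=> ef; elim: n => [|n IH].
  by apply: (expspan_ext _ (expspan_cst 1)) => x; rewrite big_nil.
by apply: (expspan_ext _ (expspanM IH (ef n))) => x; rewrite big_nat_recr.
Qed.

Lemma Lscale a l : L l -> L (fun x => a * l x).
Proof.
move=> Ll; rewrite (_ : (fun _ => _) = fun x => a * l x + 0 * l x); first exact: Llin.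
by apply/funext => x; rewrite mul0r addr0.
Qed.

Lemma expspan_expnorm l : L l ->
  exists2 D, expspan D & forall x, expR `|l x| <= D x.
Proof.
move=> Ll; exists (fun x => expR (l x) + expR (-1 * l x)).
  by apply: expspanD; apply: expspan_exp => //; exact: Lscale.
move=> x; rewrite mulN1r; have := expR_ge0 (l x); have := expR_ge0 (- l x).
by case: (ler0P (l x)) => _; lra.
Qed.


(** A functional [l] is the derivative of exp (t l) with respect to [t] at 0. *)
Lemma expspan_id l : L l -> expspan l.
Proof.
move=> Ll; have [D eD lD] := expspan_expnorm (Lscale 2 Ll).
apply: (@expspan_lim (fun n x => n.+1%:R * (expR (l x / n.+1%:R) - 1)) _ D) => //.
- move=> n; apply: (expspanZ); apply: (expspanD).
    have := expspan_exp (Lscale n.+1%:R^-1 Ll); apply: expspan_ext => x.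
    by rewrite mulrC.
  exact: expspan_cst.
- by move=> n x; apply: le_trans (lD x); exact: expRB1_dominated.
- by move=> x; exact: cvg_expRB1.
Qed.

(** The partial sums of the power series of the sine are polynomials, dominated by an
    exponential.  The sine is the first bounded function obtained, and the step where
    no integrability is left to worry about. *)
Lemma expspan_sin l : L l -> expspan (fun x => sin (l x)).
Proof.
move=> Ll; have [D eD lD] := expspan_expnorm Ll.
apply: (@expspan_lim (fun n x => series (sin_coeff (l x)) n) _ D) => //.
- move=> n; apply: (expspan_sum) => i.
  have := expspanX i (expspan_id Ll).
  move=> /(expspanZ ((odd i)%:R * (-1) ^+ i.-1./2 / i`!%:R)).
  apply: expspan_ext => x; rewrite /sin_coeff /=; ring.
- by move=> n x; apply: le_trans (lD x); exact: series_sin_coeff_dominated.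
- by move=> x; exact: cvg_series_sin.
Qed.

Lemma expspan_newton_sgn n f : expspan f -> expspan (fun x => newton_sgn n (f x)).
Proof.
move=> ef; elim: n => [//|n IH] /=.
have h := expspanD (expspan_cst 3) (expspanZ (-1) (expspanX 2 IH)).
have := expspanZ 2^-1 (expspanM IH h).
by apply: expspan_ext => x; rewrite mulN1r mulrC.
Qed.

Lemma expspan_sg l : L l -> expspan (fun x => Num.sg (l x)).
Proof.
move=> Ll; have e1 := expspan_cst 1.
have sg1 (y : R) : `|Num.sg y| <= 1 by rewrite normr_sg lern1 leq_b1.
apply: (@expspan_lim (fun n x => Num.sg (sin (l x / n.+1%:R))) _ (fun=> 1)) => //;
  last by move=> x; exact: cvg_sgn_sin.
move=> n; apply: (@expspan_lim (fun k x => newton_sgn k (sin (l x / n.+1%:R))) _ (fun=> 1)) => //.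
- move=> k.
  apply: expspan_newton_sgn; have := expspan_sin (Lscale n.+1%:R^-1 Ll).
  by apply: expspan_ext => x; rewrite mulrC.
- by move=> k x; apply: newton_sgn_le1; exact: sin_max.
- by move=> x; apply: cvg_newton_sgn; exact: sin_max.
Qed.

(** The indicator of a half-space is a polynomial in the sign, namely
    1 - (s + s^2) / 2; the rest is products and a bounded limit. *)
Lemma expspan_indic (l : nat -> T -> R) : (forall k, L (l k)) ->
  expspan (\1_[set x | forall k, l k x <= 0]).
Proof.
move=> Ll; have e1 := expspan_cst 1.
pose i k x : R := (l k x <= 0)%R%:R.
have ei k : expspan (i k).
  have es := expspan_sg (Ll k).
  have := expspanD e1 (expspanZ (- 2^-1) (expspanD es (expspanX 2 es))).
  apply: expspan_ext => x; rewrite /i; case: (sgrP (l k x)) => _; rewrite ?lexx /=; lra.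
apply: (@expspan_lim (fun n x => \prod_(0 <= k < n) i k x) _ (fun=> 1)) => //.
- by move=> n; exact: expspan_prod.
- move=> n x; rewrite ger0_norm; last by apply: prodr_ge0 => k _; exact: ler0n.
  by apply: prodr_ile1 => k _; rewrite ler0n lern1 leq_b1.
- move=> x; rewrite indicE; case: (pselect (forall k, l k x <= 0)) => [h|].
    rewrite mem_set//; apply: cvg_near_cst; apply: nearW => n.
    by apply: big1 => k _; rewrite /i h.
  move=> h; have [k /negP lk] : exists k, ~ (l k x <= 0)%R by exact/existsNP.
  rewrite memNset//; apply: cvg_near_cst; near=> n.
  rewrite (@big_cat_nat _ _ _ k)//=; last by near: n; exact: nbhs_infty_ge.
  rewrite [X in _ * X]big_ltn; last by near: n; exact: nbhs_infty_gt.
  by rewrite {2}/i (negbTE lk) mul0r mulr0.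
Unshelve. all: by end_near. Qed.

End ExpSpan.

(** * Uniqueness from moment generating functions, and Gaussian laws *)

Section ExpSpanIntegral.
Context {R : realType} {T : Type} (L : set (T -> R)).
Hypothesis Llin : forall a b l m, L l -> L m -> L (fun x => a * l x + b * m x).
Hypothesis Lcst : forall c, L (fun=> c).
Context {d1 d2 : measure_display} {T1 : measurableType d1} {T2 : measurableType d2}.
Context (m1 : {measure set T1 -> \bar R}) (m2 : {measure set T2 -> \bar R}).
Context (A : T1 -> T) (B : T2 -> T).
Hypothesis mA : forall l, L l -> measurable_fun setT (fun w => l (A w)).
Hypothesis mB : forall l, L l -> measurable_fun setT (fun w => l (B w)).
Hypothesis expA : forall l, L l -> (\int[m1]_w (expR (l (A w)))%:E < +oo)%E.
Hypothesis expAB : forall l, L l ->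
  (\int[m1]_w (expR (l (A w)))%:E = \int[m2]_w (expR (l (B w)))%:E)%E.

(** Induction on the construction of [f]; the limit step is the dominated
    convergence theorem. *)
Lemma expspan_integral f : expspan L f ->
  [/\ m1.-integrable setT (fun w => (f (A w))%:E),
      m2.-integrable setT (fun w => (f (B w))%:E) &
      (\int[m1]_w (f (A w))%:E = \int[m2]_w (f (B w))%:E)%E].
Proof.
elim=> {f} [l Ll|a f g _ [fA fB fAB] _ [gA gB gAB]|f_ f D _ IH _ [DA DB _] fD ff].
- split=> //.
  + apply/integrableP; split.
      apply/measurable_EFinP; apply: measurableT_comp => //; exact: mA.
    under eq_integral do rewrite /= ger0_norm ?expR_ge0//.
    exact: expA.
  + apply/integrableP; split.
      apply/measurable_EFinP; apply: measurableT_comp => //; exact: mB.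
    under eq_integral do rewrite /= ger0_norm ?expR_ge0//.
    by rewrite -expAB// expA.
  + exact: expAB.
- have eA : (fun w => (a * f (A w) + g (A w))%:E) =
      ((fun w => a%:E * (f (A w))%:E) \+ (fun w => (g (A w))%:E))%E by [].
  have eB : (fun w => (a * f (B w) + g (B w))%:E) =
      ((fun w => a%:E * (f (B w))%:E) \+ (fun w => (g (B w))%:E))%E by [].
  have iA : m1.-integrable setT (fun w => a%:E * (f (A w))%:E)%E by exact: integrableZl.
  have iB : m2.-integrable setT (fun w => a%:E * (f (B w))%:E)%E by exact: integrableZl.
  rewrite eA eB; split; [exact: integrableD|exact: integrableD|].
  by rewrite !integralD// !integralZl// fAB gAB.
- have domA : [/\ m1.-integrable setT (fun w => (f (A w))%:E), True &
      (\int[m1]_w (f_ n (A w))%:E @[n --> \oo] --> \int[m1]_w (f (A w))%:E)%E].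
    have mf n : measurable_fun setT (fun w => (f_ n (A w))%:E).
      by have [/measurable_int] := IH n.
    have fl x : setT x -> (f_ n (A x))%:E @[n --> \oo] --> (f (A x))%:E.
      by move=> _; apply: cvg_EFin; [exact: nearW|exact: ff].
    have [] := @dominated_convergence _ _ _ m1 _ measurableT
      (fun n w => (f_ n (A w))%:E) (fun w => (f (A w))%:E) (fun w => (D (A w))%:E) mf.
    + exact: emeasurable_fun_cvg fl.
    + exact: aeW.
    + exact: DA.
    + by apply: aeW => x n _; rewrite lee_fin; exact: fD.
    + by move=> *; split.
  have domB : [/\ m2.-integrable setT (fun w => (f (B w))%:E), True &
      (\int[m2]_w (f_ n (B w))%:E @[n --> \oo] --> \int[m2]_w (f (B w))%:E)%E].
    have mf n : measurable_fun setT (fun w => (f_ n (B w))%:E).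
      by have [_ /measurable_int] := IH n.
    have fl x : setT x -> (f_ n (B x))%:E @[n --> \oo] --> (f (B x))%:E.
      by move=> _; apply: cvg_EFin; [exact: nearW|exact: ff].
    have [] := @dominated_convergence _ _ _ m2 _ measurableT
      (fun n w => (f_ n (B w))%:E) (fun w => (f (B w))%:E) (fun w => (D (B w))%:E) mf.
    + exact: emeasurable_fun_cvg fl.
    + exact: aeW.
    + exact: DB.
    + by apply: aeW => x n _; rewrite lee_fin; exact: fD.
    + by move=> *; split.
  have [iA _ lA] := domA; have [iB _ lB] := domB; split=> //.
  apply: (cvg_unique _ lA); first exact: ereal_hausdorff.
  by rewrite (_ : (fun n => _) = (fun n => \int[m2]_w (f_ n (B w))%:E)%E)//;
    apply/funext => n; have [] := IH n.
Qed.

Lemma eq_measure_polyhedron (l : nat -> T -> R) : (forall k, L (l k)) ->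
  m1 [set w | forall k, l k (A w) <= 0] = m2 [set w | forall k, l k (B w) <= 0].
Proof.
move=> Ll; have [_ _] := expspan_integral (expspan_indic Llin Lcst Ll).
have mset d (S : measurableType d) (C : S -> T) :
    (forall l, L l -> measurable_fun setT (fun w => l (C w))) ->
    measurable [set w | forall k, l k (C w) <= 0].
  move=> mC; rewrite (_ : [set _ | _] =
      \bigcap_k ((fun w => l k (C w)) @^-1` `]-oo, 0])); last first.
    apply/seteqP; split=> [w /= h k _|w h k]; first by rewrite /= in_itv /=; exact: h.
    by have := h k Logic.I; rewrite /= in_itv.
  apply: bigcapT_measurable => k; rewrite -[X in measurable X]setTI.
  by apply: mC.
have E d (S : measurableType d) (C : S -> T) w :
    \1_[set x | forall k, l k x <= 0] (C w) =
    \1_[set w | forall k, l k (C w) <= 0] w :> R.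
  by rewrite !indicE; congr (nat_of_bool _)%:R; apply/idP/idP; rewrite !inE.
under eq_integral do rewrite E.
under [in RHS]eq_integral do rewrite E.
by rewrite !integral_indic ?setIT//; apply: mset.
Qed.

End ExpSpanIntegral.

Section NormalMGF.
Context {R : realType}.
Local Notation mu := (@lebesgue_measure R).

(** The density of the normal law is almost everywhere its Radon-Nikodym derivative. *)
Lemma integral_normal_prob (m s : R) (f : R -> \bar R) :
  (forall x, 0 <= f x)%E -> measurable_fun setT f ->
  (\int[normal_prob m s]_x f x = \int[mu]_x (f x * (normal_pdf m s x)%:E))%E.
Proof.
move=> f0 mf; have dom := normal_prob_dominates m s.
rewrite -(Radon_Nikodym_SigmaFinite.change_of_variables dom f0)//.
apply: ae_eq_integral => //.
- apply: emeasurable_funM => //; apply: (measurable_int mu).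
  exact: Radon_Nikodym_SigmaFinite.f_integrable.
- apply: emeasurable_funM => //; apply/measurable_EFinP; exact: measurable_normal_pdf.
- apply: ae_eqe_mul2l; apply: integral_ae_eq => //.
  + exact: Radon_Nikodym_SigmaFinite.f_integrable.
  + apply/measurable_EFinP; exact: measurable_normal_pdf.
  + by move=> A _ mA; rewrite -Radon_Nikodym_SigmaFinite.f_integral.
Qed.

(** Completing the square: an exponential tilt of a normal density is, up to its
    mass, the normal density with a shifted mean.  The total mass of the latter then
    gives the moment generating function. *)
Lemma normal_pdf_tilt (m s t x : R) : s != 0 ->
  expR (t * x) * normal_pdf m s x =
  expR (m * t + s ^+ 2 * t ^+ 2 / 2) * normal_pdf (m + s ^+ 2 * t) s x.
Proof.
move=> s0; rewrite !normal_pdfE// mulrCA [RHS]mulrCA; congr (_ * _).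
rewrite /normal_fun -!expRD; congr expR; field.
by rewrite s0.
Qed.

Lemma normal_prob_mgf (m s t : R) : s != 0 ->
  (\int[normal_prob m s]_x (expR (t * x))%:E =
   (expR (m * t + s ^+ 2 * t ^+ 2 / 2))%:E)%E.
Proof.
move=> s0; rewrite integral_normal_prob.
- under eq_integral do rewrite -EFinM normal_pdf_tilt// EFinM.
  rewrite ge0_integralZl//=.
  + by rewrite integral_normal_pdf mule1.
  + by apply/measurable_EFinP; exact: measurable_normal_pdf.
  + by move=> x _; rewrite lee_fin normal_pdf_ge0.
- by move=> x; rewrite lee_fin expR_ge0.
- by apply/measurable_EFinP; apply: measurableT_comp => //; exact: measurable_funM.
Qed.

Lemma real_gaussian_mgf (d : measure_display) (Omega : measurableType d)
    (P : probability Omega R) (Z : Omega -> R) : real_gaussian P Z ->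
  exists m s : R, forall t,
    (\int[P]_w (expR (t * Z w))%:E = (expR (m * t + s ^+ 2 * t ^+ 2 / 2))%:E)%E.
Proof.
move=> [mZ [m [s law]]]; exists m, s => t.
have mexp : measurable_fun [set: R] (fun x : R => (expR (t * x))%:E).
  by apply/measurable_EFinP; apply: measurableT_comp => //; exact: measurable_funM.
have mZ' : measurable_fun setT (Z : Omega -> measurableTypeR R) := mZ.
pose Zm : {mfun Omega >-> measurableTypeR R} :=
  HB.pack Z (isMeasurableFun.Build _ _ _ _ _ mZ').
have <- : (\int[distribution P Zm]_x (expR (t * x))%:E = \int[P]_w (expR (t * Z w))%:E)%E.
  by rewrite ge0_integral_pushforward// => x _; rewrite lee_fin expR_ge0.
move: law; rewrite /gaussian_law; have [->|s0] := eqVneq s 0 => law.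
  transitivity (\int[@dirac _ (measurableTypeR R) m R]_x (expR (t * x))%:E)%E.
    by apply: eq_measure_integral => A mA _; exact: law.
  rewrite integral_dirac// diracT mul1e; congr (expR _)%:E; ring.
rewrite -(normal_prob_mgf m t s0).
by apply: eq_measure_integral => A mA _; exact: law.
Qed.

End NormalMGF.

(** * Product integrals and second moments *)

Lemma integral_prodM (R : realType) d1 d2 (T1 : measurableType d1)
    (T2 : measurableType d2) (P1 : probability T1 R) (P2 : probability T2 R)
    (f : T1 -> R) (g : T2 -> R) :
  (forall x, 0 <= f x) -> (forall x, 0 <= g x) ->
  measurable_fun setT f -> measurable_fun setT g ->
  (\int[P1 \x P2]_w (f w.1 * g w.2)%:E = \int[P1]_x (f x)%:E * \int[P2]_y (g y)%:E)%E.
Proof.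
move=> f0 g0 mf mg; rewrite fubini_tonelli1.
- have -> : fubini_F P2 (fun w : T1 * T2 => (f w.1 * g w.2)%:E) =
      (fun x => (f x)%:E * \int[P2]_y (g y)%:E)%E.
    apply/funext => x; rewrite /fubini_F /=.
    under eq_integral do rewrite EFinM.
    rewrite ge0_integralZl//; first exact/measurable_EFinP.
    + by move=> y _; rewrite lee_fin.
    + by rewrite lee_fin.
  rewrite ge0_integralZr//; first exact/measurable_EFinP.
  + by move=> x _; rewrite lee_fin.
  + by apply: integral_ge0 => y _; rewrite lee_fin.
- apply/measurable_EFinP; apply: measurable_funM.
    exact: (measurableT_comp mf measurable_fst).
  exact: (measurableT_comp mg measurable_snd).
- by move=> x; rewrite lee_fin mulr_ge0.
Qed.

Definition centered_mgf (R : realType) d (Omega : measurableType d)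
    (P : probability Omega R) (Z : Omega -> R) (q : R) : Prop :=
  forall t, (\int[P]_w (expR (t * Z w))%:E = (expR (q * t ^+ 2))%:E)%E.

Section SecondMoment.
Context {R : realType} (d : measure_display) (Omega : measurableType d).
Context (P : probability Omega R) (Z : Omega -> R) (q : R).
Hypothesis mZ : measurable_fun setT Z.
Hypothesis mgfZ : centered_mgf P Z q.

Let mexp t : measurable_fun setT (fun w => (expR (t * Z w))%:E).
Proof.
by apply/measurable_EFinP; apply: measurableT_comp => //; exact: measurable_funM.
Qed.

Let iexp t : P.-integrable setT (fun w => (expR (t * Z w))%:E).
Proof.
apply/integrableP; split; first exact: mexp.
under eq_integral do rewrite /= ger0_norm ?expR_ge0//.
by rewrite mgfZ ltry.
Qed.

(** The square of [Z] is the dominated limit of the squares of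
    n (exp (Z / n) - 1).  Expanding them, their integrals are explicit in the moment
    generating function at 2 / n, 1 / n and 0, and tend to 4 q - 2 q. *)
Lemma integral_sqr_of_mgf : (\int[P]_w (Z w ^+ 2)%:E = (2 * q)%:E)%E.
Proof.
pose f_ n w := (n.+1%:R * (expR (Z w / n.+1%:R) - 1)) ^+ 2.
(* The constant term is written as the exponential of 0 * Z w so that the moment
   generating function computes all three integrals. *)
have fE n : (fun w => (f_ n w)%:E) = (fun w =>
    (n.+1%:R ^+ 2)%:E * (expR (2 / n.+1%:R * Z w))%:E +
    ((- 2 * n.+1%:R ^+ 2)%:E * (expR (n.+1%:R^-1 * Z w))%:E +
     (n.+1%:R ^+ 2)%:E * (expR (0 * Z w))%:E))%E.
  apply/funext => w; rewrite -!EFinM -!EFinD; congr EFin.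
  have -> : 2 / n.+1%:R * Z w = Z w / n.+1%:R + Z w / n.+1%:R by field.
  rewrite mul0r expR0 expRD [_^-1 * Z w]mulrC /f_; ring.
have intf n : (\int[P]_w (f_ n w)%:E =
    ((n.+1 ^ 2)%:R * (expR (4 * q / (n.+1 ^ 2)%:R) - 1) -
     2 * ((n.+1 ^ 2)%:R * (expR (q / (n.+1 ^ 2)%:R) - 1)))%:E)%E.
  rewrite fE integralD//; last 2 first.
  - exact: integrableZl.
  - by apply: integrableD => //; exact: integrableZl.
  rewrite integralD//; try exact: integrableZl.
  rewrite !integralZl// !mgfZ -!EFinM -!EFinD; congr EFin.
  have -> : q * (2 / n.+1%:R) ^+ 2 = 4 * q / (n.+1 ^ 2)%:R.
    by rewrite natrX; field.
  have -> : q * n.+1%:R^-1 ^+ 2 = q / (n.+1 ^ 2)%:R by rewrite natrX exprVn.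
  rewrite expr0n mulr0 expR0 natrX; ring.
have sub : (fun n => (n.+1 ^ 2).-1) @ \oo --> \oo.
  move=> A [N _ NA]; exists N => // n Nn; apply: NA; rewrite /mkset.
  have : (n.+1 <= n.+1 ^ 2)%N by rewrite -{1}(expn1 n.+1) leq_pexp2l.
  by case: (n.+1 ^ 2)%N => // m; exact: (leq_trans Nn).
have lim (y : R) : (n.+1 ^ 2)%:R * (expR (y / (n.+1 ^ 2)%:R) - 1) @[n --> \oo] --> y.
  have := @cvg_comp _ _ _ _ _ _ _ _ sub (@cvg_expRB1 R y).
  apply: cvg_trans; apply: near_eq_cvg; apply: nearW => n.
  by rewrite /comp prednK ?expn_gt0.
have [] := @dominated_convergence _ _ _ P _ measurableT (fun n w => (f_ n w)%:E)
  (fun w => (Z w ^+ 2)%:E) (fun w => (expR (4 * Z w))%:E + (expR ((- 4) * Z w))%:E)%E.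
- move=> n; rewrite fE; apply: emeasurable_funD; first exact: measurable_funeM.
  by apply: emeasurable_funD; exact: measurable_funeM.
- by apply/measurable_EFinP; exact: measurable_funX.
- apply: aeW => w _; apply: cvg_EFin; first exact: nearW.
  by rewrite /= expr2; apply: cvgM; exact: cvg_expRB1.
- exact: integrableD.
- apply: aeW => w n _; rewrite -EFinD /= lee_fin /f_ normrX.
  apply: (@le_trans _ _ (expR `|2 * Z w| ^+ 2)).
    by rewrite lerXn2r ?nnegrE ?expR_ge0//; exact: expRB1_dominated.
  rewrite expr2 -expRD -mulr2n -[_ *+ 2]mulr_natl -{1}(ger0_norm (_ : 0 <= 2))// -normrM.
  have -> : 2 * (2 * Z w) = 4 * Z w :> R by ring.
  have -> : - 4 * Z w = - (4 * Z w) :> R by ring.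
  have := expR_ge0 (4 * Z w); have := expR_ge0 (- (4 * Z w)).
  by case: (ler0P (4 * Z w)) => _; lra.
move=> _ _ lf; apply: (cvg_unique _ lf); first exact: ereal_hausdorff.
rewrite (_ : (2 * q)%:E = (4 * q - 2 * q)%:E); last by congr EFin; ring.
rewrite (_ : (fun n => _) = (fun n => ((n.+1 ^ 2)%:R * (expR (4 * q / (n.+1 ^ 2)%:R) - 1) -
     2 * ((n.+1 ^ 2)%:R * (expR (q / (n.+1 ^ 2)%:R) - 1)))%:E)); last first.
  by apply/funext => n; exact: intf.
apply: cvg_EFin; first exact: nearW.
by apply: cvgB; [exact: lim|apply: cvgM; [exact: cvg_cst|exact: lim]].
Qed.

End SecondMoment.

(** * Rotation invariance of a pair of independent copies *)

(** The constraints defining a polar set come naturally indexed by a sign and an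
    integer.  An integer that encodes no index carries the trivial constraint
    0 <= 0. *)
Lemma countable_constraints (R : realType) (T : Type) (I : countType)
    (L : set (T -> R)) (l : I -> T -> R) : L (fun=> 0) -> (forall i, L (l i)) ->
  exists2 l' : nat -> T -> R, (forall k, L (l' k)) &
    forall x, (forall k, l' k x <= 0) <-> (forall i, l i x <= 0).
Proof.
move=> L0 Ll; exists (fun k => if unpickle k is Some i then l i else fun=> 0).
  by move=> k; case: unpickle.
move=> x; split=> [h i|h k]; last by case: unpickle.
by have := h (pickle i); rewrite pickleK.
Qed.

Section Dual.
Context {R : realType} {E : normedModType R}.

Definition dual : set (E -> R) :=
  [set f : E -> R | exists2 th : {linear E -> R^o}, continuous th & f = th].

Lemma dual_lin a b f g : dual f -> dual g -> dual (fun x => a * f x + b * g x).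
Proof.
move=> [th cth ->] [eta ceta ->].
exists ((a \*: th) \+ (b \*: eta) : {linear E -> R^o}) => // x.
by apply: (@cvgD _ R^o); apply: (@cvgZl_tmp _ R^o); [exact: cth|exact: ceta].
Qed.

Lemma dual0 : dual (fun=> 0).
Proof. by exists (\0 : {linear E -> R^o}) => // x; exact: cvg_cst. Qed.

Lemma dualD f x y : dual f -> f (x + y) = f x + f y.
Proof. by move=> [th _ ->]; rewrite linearD. Qed.

Lemma dualB f x y : dual f -> f (x - y) = f x - f y.
Proof. by move=> [th _ ->]; rewrite linearB. Qed.

Lemma dualZ f a x : dual f -> f (a *: x) = a * f x.
Proof. by move=> [th _ ->]; rewrite linearZ. Qed.

Definition biaffine : set (E * E -> R) :=
  [set h | exists f g c, [/\ dual f, dual g & h = fun z => f z.1 + g z.2 + c]].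

Lemma biaffine_lin a b h k : biaffine h -> biaffine k ->
  biaffine (fun x => a * h x + b * k x).
Proof.
move=> [f [g [c [df dg ->]]]] [f' [g' [c' [df' dg' ->]]]].
exists (fun x => a * f x + b * f' x), (fun x => a * g x + b * g' x), (a * c + b * c').
split; [exact: dual_lin|exact: dual_lin|].
by apply/funext => z; ring.
Qed.

Lemma biaffine_cst c : biaffine (fun=> c).
Proof.
exists (fun=> 0), (fun=> 0), c; split; [exact: dual0|exact: dual0|].
by apply/funext => z; rewrite !add0r.
Qed.

Definition polar (f : nat -> E -> R) (t : R) : set E := [set x | forall k, `|f k x| <= t].

End Dual.

(** The normal laws enter the estimates below only through this property of
    the one-dimensional marginals. *)
Definition centered_gaussian (R : realType) (E : normedModType R) d
    (Omega : measurableType d) (P : probability Omega R) (U : Omega -> E) : Prop :=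
  forall f, dual f -> measurable_fun setT (f \o U) /\
    exists q, centered_mgf P (fun w => f (U w)) q.

Section Rotation.
Context {R : realType} {E : normedModType R}.
Context (d : measure_display) (Omega : measurableType d) (P : probability Omega R).
Context (U : Omega -> E).
Hypothesis centU : centered_gaussian P U.

(* both the cosine and the sine of the rotation by an eighth of a turn *)
Let c : R := (Num.sqrt 2)^-1.

Let cc : c * c = 2^-1.
Proof. by rewrite /c -invfM -expr2 sqr_sqrtr. Qed.

(** Twice [q] is the second moment of the functional, and second moments obey
    the parallelogram law because squares of real numbers do. *)
Lemma parallelogram f g qf qg q1 q2 : dual f -> dual g ->
  let mgf (h : E -> R) := centered_mgf P (fun w => h (U w)) in
  mgf f qf -> mgf g qg ->
  mgf (fun x => c * f x + c * g x) q1 -> mgf (fun x => c * f x + - c * g x) q2 ->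
  q1 + q2 = qf + qg.
Proof.
move=> df dg mgf hf hg h1 h2.
have d1 := dual_lin c c df dg; have d2 := dual_lin c (- c) df dg.
have m h : dual h -> measurable_fun setT (fun w => h (U w)) by move=> /centU[].
have M h q : dual h -> mgf h q -> (\int[P]_w (h (U w) ^+ 2)%:E = (2 * q)%:E)%E.
  by move=> dh mh; exact: integral_sqr_of_mgf (m _ dh) mh.
have S h k : dual h -> dual k ->
    (\int[P]_w (h (U w) ^+ 2 + k (U w) ^+ 2)%:E =
     \int[P]_w (h (U w) ^+ 2)%:E + \int[P]_w (k (U w) ^+ 2)%:E)%E.
  move=> dh dk; under eq_integral do rewrite EFinD.
  rewrite ge0_integralD//; try by move=> w _; rewrite lee_fin sqr_ge0.
    by apply/measurable_EFinP/measurable_funX; exact: m.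
  by apply/measurable_EFinP/measurable_funX; exact: m.
have := S _ _ d1 d2; rewrite (M _ _ d1 h1) (M _ _ d2 h2).
have -> : (fun w => ((c * f (U w) + c * g (U w)) ^+ 2 +
                   (c * f (U w) + - c * g (U w)) ^+ 2)%:E) =
          (fun w => (f (U w) ^+ 2 + g (U w) ^+ 2)%:E).
  apply/funext => w; congr EFin.
  transitivity (2 * (c * c) * (f (U w) ^+ 2 + g (U w) ^+ 2)); first by ring.
  by rewrite cc mulfV// mul1r.
rewrite (S _ _ df dg) (M _ _ df hf) (M _ _ dg hg) -!EFinD => -[]; lra.
Qed.

Let Ux (w : Omega * Omega) := (U w.1, U w.2).
Let Ur (w : Omega * Omega) := (c *: (U w.1 + U w.2), c *: (U w.1 - U w.2)).

Let mU1 f : dual f -> measurable_fun setT (fun w : Omega * Omega => f (U w.1)).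
Proof. by move=> df; exact: measurableT_comp (centU df).1 measurable_fst. Qed.

Let mU2 f : dual f -> measurable_fun setT (fun w : Omega * Omega => f (U w.2)).
Proof. by move=> df; exact: measurableT_comp (centU df).1 measurable_snd. Qed.

Let exp_indep f g r : dual f -> dual g ->
  (\int[P \x P]_w (expR (f (U w.1) + g (U w.2) + r))%:E =
   (expR r)%:E * (\int[P]_w (expR (f (U w)))%:E * \int[P]_w (expR (g (U w)))%:E))%E.
Proof.
move=> df dg.
have mf := (centU df).1; have mg := (centU dg).1.
have me h : dual h -> measurable_fun setT (fun w => expR (h (U w))).
  by move=> /centU[mh _]; exact: measurableT_comp.
under eq_integral => w _ do rewrite -addrC expRD expRD EFinM.
rewrite ge0_integralZl//.
- rewrite (@integral_prodM _ _ _ _ _ P P (fun w => expR (f (U w))) (fun w => expR (g (U w))))//;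
  try (by move=> x; exact: expR_ge0); exact: me.
- apply/measurable_EFinP; apply: measurable_funM; apply: measurableT_comp => //.
    exact: mU1.
  exact: mU2.
Qed.

(** An affine functional of the rotated pair is, up to its constant, f' U + g' U'
    for rotated functionals f' and g'.  By independence its exponential has integral
    exp (q1 + q2), which the parallelogram law identifies with exp (qf + qg). *)
Lemma rotation_law (I : countType) (l : I -> E * E -> R) : (forall i, biaffine (l i)) ->
  (P \x P)%E [set w | forall i, l i (Ux w) <= 0] =
  (P \x P)%E [set w | forall i, l i (Ur w) <= 0].
Proof.
move=> bl; have [l' bl' ll'] := countable_constraints (biaffine_cst 0) bl.
have l'E (C : Omega * Omega -> E * E) :
    [set w | forall i, l i (C w) <= 0] = [set w | forall k, l' k (C w) <= 0].
  by apply/seteqP; split=> w /ll'.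
rewrite !l'E.
have mgfP f : dual f -> exists q, centered_mgf P (fun w => f (U w)) q /\
    (\int[P]_w (expR (f (U w)))%:E = (expR q)%:E)%E.
  move=> /centU[_ [q hq]]; exists q; split=> //.
  have := hq 1; rewrite expr1n mulr1 => <-.
  by apply: eq_integral => w _; rewrite mul1r.
have UrE f g r w : dual f -> dual g -> f (Ur w).1 + g (Ur w).2 + r =
    (fun x => c * f x + c * g x) (U w.1) + (fun x => c * f x + - c * g x) (U w.2) + r.
  by move=> df dg; rewrite /Ur /= (dualZ _ _ df) (dualZ _ _ dg) (dualD _ _ df) (dualB _ _ dg); ring.
apply: (@eq_measure_polyhedron _ _ biaffine biaffine_lin biaffine_cst _ _ _ _
  (P \x P)%E (P \x P)%E Ux Ur _ _ _ _ l' bl') => _ [f [g [r [df dg ->]]]].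
- by apply: measurable_funD => //; apply: measurable_funD; [exact: mU1|exact: mU2].
- rewrite (_ : (fun w => _) = (fun w => (fun x => c * f x + c * g x) (U w.1) +
    (fun x => c * f x + - c * g x) (U w.2) + r)).
    apply: measurable_funD => //; apply: measurable_funD.
      exact: (mU1 (dual_lin c c df dg)).
    exact: (mU2 (dual_lin c (- c) df dg)).
  by apply/funext => w; exact: UrE.
- have [qf [_ hf]] := mgfP _ df; have [qg [_ hg]] := mgfP _ dg.
  by rewrite (exp_indep r df dg) hf hg -!EFinM ltry.
- have [qf [hf hf1]] := mgfP _ df; have [qg [hg hg1]] := mgfP _ dg.
  have d1 := dual_lin c c df dg; have d2 := dual_lin c (- c) df dg.
  have [q1 [h1 h11]] := mgfP _ d1; have [q2 [h2 h21]] := mgfP _ d2.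
  rewrite (exp_indep r df dg) hf1 hg1.
  under [RHS]eq_integral do rewrite UrE//.
  rewrite (exp_indep r d1 d2) h11 h21; congr (_ * _)%E.
  by rewrite -!EFinM -!expRD (parallelogram df dg hf hg h1 h2).
Qed.

End Rotation.

(** * Fernique's inequality for the gauge of a polar set *)

Section Mass.
Context {R : realType} {E : normedModType R}.
Context (d : measure_display) (Omega : measurableType d) (P : probability Omega R).
Context (U : Omega -> E) (f : nat -> E -> R).
Hypothesis mfU : forall k, measurable_fun setT (f k \o U).

Lemma measurable_polar (t : R) : measurable (U @^-1` polar f t).
Proof.
rewrite (_ : _ @^-1` _ = \bigcap_k ((f k \o U) @^-1` `[- t, t])).
  apply: bigcapT_measurable => k; rewrite -[X in measurable X]setTI.
  by apply: mfU.
apply/seteqP; split=> [w h k _|w h k].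
  by rewrite /= in_itv /= -ler_norml; exact: h.
by have := h k Logic.I; rewrite /= in_itv /= -ler_norml.
Qed.

Definition mass (t : R) : R := fine (P (U @^-1` polar f t)).

Lemma massE t : P (U @^-1` polar f t) = (mass t)%:E.
Proof. by rewrite fineK// fin_num_measure//; exact: measurable_polar. Qed.

Lemma massC t : P (U @^-1` ~` polar f t) = (1 - mass t)%:E.
Proof.
by rewrite -preimage_setC probability_setC ?massE//; exact: measurable_polar.
Qed.

Lemma mass_ge0 t : 0 <= mass t. Proof. exact: fine_ge0. Qed.

Lemma mass_le1 t : mass t <= 1.
Proof. by rewrite -lee_fin -massE probability_le1//; exact: measurable_polar. Qed.

Lemma le_mass s t : s <= t -> mass s <= mass t.
Proof.
move=> st; rewrite -lee_fin -!massE; apply: le_measure.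
- by rewrite inE; exact: measurable_polar.
- by rewrite inE; exact: measurable_polar.
- by move=> w /= h k; apply: le_trans (h k) st.
Qed.

End Mass.

Section Fernique.
Context {R : realType} {E : normedModType R}.
Context (d : measure_display) (Omega : measurableType d) (P : probability Omega R).
Context (U : Omega -> E).
Hypothesis centU : centered_gaussian P U.
Context (f : nat -> E -> R).
Hypothesis df : forall k, dual (f k).

Let c : R := (Num.sqrt 2)^-1.

Let cc : c * c = 2^-1.
Proof. by rewrite /c -invfM -expr2 sqr_sqrtr. Qed.

Let c0 : 0 < c. Proof. by rewrite /c invr_gt0 sqrtr_gt0. Qed.

Let mfU k : measurable_fun setT (f k \o U) := (centU (df k)).1.

Let measurable_polar := measurable_polar mfU.
Let massE := massE P mfU.
Let massC := massC P mfU.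
Let mass_ge0 := mass_ge0 P U f.
Let mass_le1 := mass_le1 P mfU.
Let le_mass := le_mass P mfU.
Local Notation mass := (mass P U f).

(* signed functionals, which turn the bound on an absolute value into half-spaces *)
Let sgf (b : bool) k x : R := (-1) ^+ b * f k x.

Let dual_sgf b k : dual (sgf b k).
Proof.
rewrite (_ : sgf b k = fun x => (-1) ^+ b * f k x + 0 * f k x).
  exact: dual_lin.
by apply/funext => x; rewrite mul0r addr0.
Qed.

Let polarP t x : polar f t x <-> forall b k, sgf b k x - t <= 0.
Proof.
rewrite /sgf; split=> [h b k|h k].
  have := h k; rewrite ler_norml => /andP[? ?].
  by case: b; rewrite ?expr1 ?expr0 ?mulN1r ?mul1r; lra.
rewrite ler_norml; have := h true k; have := h false k.
by rewrite expr1 expr0 mulN1r mul1r => *; apply/andP; split; lra.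
Qed.

Lemma rotation_polar s :
  (P \x P)%E [set w | polar f s (c *: (U w.1 + U w.2))] = (mass s)%:E.
Proof.
pose l (i : bool * nat) (z : E * E) := sgf i.1 i.2 z.1 - s.
have lP z : (forall i, l i z <= 0) <-> polar f s z.1.
  split=> [h|/polarP h [b k]]; last exact: h.
  by apply/polarP => b k; exact: (h (b, k)).
have bl i : biaffine (l i).
  exists (sgf i.1 i.2), (fun=> 0), (- s); split=> //; first exact: dual0.
  by apply/funext => z; rewrite /l addr0.
have := rotation_law centU bl.
rewrite (_ : [set w | _] = (U @^-1` polar f s) `*` setT); last first.
  by apply/seteqP; split=> [w /lP|w []] //= h _; apply/lP.
rewrite product_measure1E//.
rewrite [X in (_ * X)%E]probability_setT mule1 [X in X = _ -> _]massE => ->; congr ((P \x P)%E _).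
by apply/seteqP; split=> [w h|w h]; [apply/(lP (_, _)); exact: h|have := (lP _).1 h].
Qed.

Lemma rotation_polar2 s t :
  (P \x P)%E [set w | polar f s (c *: (U w.1 + U w.2)) /\
                      polar f t (c *: (U w.1 - U w.2))] = (mass s * mass t)%:E.
Proof.
pose l (i : bool * bool * nat) (z : E * E) :=
  if i.1.1 then sgf i.1.2 i.2 z.1 - s else sgf i.1.2 i.2 z.2 - t.
have lP z : (forall i, l i z <= 0) <-> polar f s z.1 /\ polar f t z.2.
  split=> [h|[/polarP h1 /polarP h2] [[[] b] k]]; last 2 first.
  - exact: h1.
  - exact: h2.
  split; apply/polarP => b k; first exact: (h (true, b, k)).
  exact: (h (false, b, k)).
have bl i : biaffine (l i).
  case: i => [[[] b] k].
    exists (sgf b k), (fun=> 0), (- s); split=> //; first exact: dual0.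
    by apply/funext => z; rewrite /l addr0.
  exists (fun=> 0), (sgf b k), (- t); split=> //; first exact: dual0.
  by apply/funext => z; rewrite /l add0r.
have := rotation_law centU bl.
rewrite (_ : [set w | _] = (U @^-1` polar f s) `*` (U @^-1` polar f t)); last first.
  by apply/seteqP; split=> [w /lP|w h] //; apply/lP.
rewrite product_measure1E//.
rewrite [X in (X * _)%E = _ -> _]massE [X in (_ * X)%E = _ -> _]massE -EFinM => ->; congr ((P \x P)%E _).
by apply/seteqP; split=> [w h|w h]; [apply/(lP (_, _)); exact: h|have := (lP _).1 h].
Qed.

(** Write a = f k U and b = f k U'.  Since a - b is both 2 a - (a + b) and
    (a + b) - 2 b, if |a + b| / sqrt 2 is at most [s] and |a - b| / sqrt 2 exceeds
    [t], then both |a| and |b| exceed (t - s) / sqrt 2. *)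
Lemma fernique_step s t :
  mass s * (1 - mass t) <= (1 - mass (c * (t - s))) ^+ 2.
Proof.
pose S := [set w : Omega * Omega | polar f s (c *: (U w.1 + U w.2))].
pose S' := [set w : Omega * Omega | polar f s (c *: (U w.1 + U w.2)) /\
  polar f t (c *: (U w.1 - U w.2))].
pose T := U @^-1` ~` polar f (c * (t - s)).
have mT : measurable T by rewrite /T -preimage_setC; apply: measurableC; exact: measurable_polar.
have mrot (b : R) u : measurable [set w : Omega * Omega | polar f u (c *: (U w.1 + b *: U w.2))].
  rewrite (_ : [set _ | _] = \bigcap_k
     ((fun w : Omega * Omega => c * (f k (U w.1) + b * f k (U w.2))) @^-1` `[- u, u])).
    apply: bigcapT_measurable => k; rewrite -[X in measurable X]setTI.
    have mf := (centU (df k)).1.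
    have m : measurable_fun setT (fun w : Omega * Omega => c * (f k (U w.1) + b * f k (U w.2))).
      apply: measurable_funM => //; apply: measurable_funD.
        exact: (measurableT_comp mf measurable_fst).
      by apply: measurable_funM => //; exact: (measurableT_comp mf measurable_snd).
    by apply: m.
  apply/seteqP; split=> [w h k _|w h k].
    rewrite /= in_itv /= -ler_norml; have := h k.
    by rewrite (dualZ _ _ (df k)) (dualD _ _ (df k)) (dualZ _ _ (df k)).
  have := h k Logic.I; rewrite /= in_itv /= -ler_norml.
  by rewrite (dualZ _ _ (df k)) (dualD _ _ (df k)) (dualZ _ _ (df k)).
have mS : measurable S.
  by have := mrot 1 s; under eq_set do rewrite scale1r.
have mS' : measurable S'.
  rewrite (_ : S' = S `&` [set w | polar f t (c *: (U w.1 + (-1) *: U w.2))]).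
    exact: measurableI.
  by under eq_set do rewrite scaleN1r.
have sub : S `\` S' `<=` T `*` T.
  move=> w [Sw nS]; have [k /negP] : exists k, ~ (`|f k (c *: (U w.1 - U w.2))| <= t)%R.
    by apply/existsNP => h; apply: nS.
  have := Sw k; rewrite !(dualZ _ _ (df k)) (dualD _ _ (df k)) (dualB _ _ (df k)).
  rewrite !normrM (gtr0_norm c0) -ltNge; set u := f k _; set v := f k _ => uv1 uv2.
  have H (y : R) : `|u - v| <= 2 * `|y| + `|u + v| -> (c * (t - s) < `|y|)%R.
    have c2 : c * (c * (2 * `|y|)) = `|y| by rewrite !mulrA cc mulVf// mul1r.
    move=> h; rewrite -c2 ltr_pM2l//.
    have := ler_wpM2l (ltW c0) h; rewrite mulrDr; lra.
  have n2 (y : R) : `|2 * y| = 2 * `|y| by rewrite normrM ger0_norm.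
  have hu : c * (t - s) < `|u|.
    apply: H; rewrite -n2 (_ : u - v = 2 * u - (u + v)); last by ring.
    exact: ler_normB.
  have hv : c * (t - s) < `|v|.
    apply: H; rewrite -n2 [leRHS]addrC (_ : u - v = (u + v) - 2 * v); last by ring.
    exact: ler_normB.
  by split=> /= /(_ k); rewrite leNgt ?hu ?hv.
have : ((P \x P) (S `\` S') <= (P \x P) (T `*` T))%E.
  apply: le_measure => //; rewrite inE; last exact: measurableX.
  exact: measurableD.
rewrite product_measure1E// [X in (_ <= X * _)%E]massC [X in (_ <= _ * X)%E]massC measureD//; last first.
  by rewrite [ltLHS]rotation_polar ltry.
have -> : S `&` S' = S' by apply/setIidPr => w [].
rewrite [X in (X - _)%E]rotation_polar [X in (_ - X)%E]rotation_polar2.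
by rewrite -EFinM -EFinB lee_fin expr2; apply: le_trans; lra.
Qed.

(** The radii r_n = s (4 sqrt 2 ^ n - 3) start at [s] and satisfy
    (r_(n+1) - s) / sqrt 2 >= r_n, because 4 / sqrt 2 <= 3; so [fernique_step] squares
    the ratio (1 - mass r_n) / mass s, whose initial value is at most
    1/19 <= exp (- 2). *)
Lemma fernique s : 0 <= s -> 19 / 20 <= mass s -> forall n,
  1 - mass (s * (4 * Num.sqrt 2 ^+ n - 3)) <= mass s * expR (- (2 * 2 ^+ n)).
Proof.
move=> s0 ms; elim=> [|n IH].
  rewrite expr0 mulr1 [4 - 3](_ : _ = 1) ?mulr1; last by ring.
  have e2 : 16^-1 <= expR (- 2) :> R.
    have h : 2^-1 <= expR (- 2^-1) :> R by have := expR_ge1Dx (- 2^-1 : R); lra.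
    have h4 : expR (- 2) = expR (- 2^-1) ^+ 4 :> R.
      by rewrite -expRM_natl; congr expR; field.
    rewrite h4 (_ : 16^-1 = (2^-1) ^+ 4 :> R); last by field.
    by rewrite lerXn2r// nnegrE ?expR_ge0//.
  have := ler_wpM2l (mass_ge0 s) e2; lra.
have sq2 : Num.sqrt 2 = c^-1 :> R by rewrite /c invrK.
have step := fernique_step s (s * (4 * Num.sqrt 2 ^+ n.+1 - 3)).
have cle : 4 * c <= 3.
  rewrite -(@ler_pXn2r _ 2)// ?nnegrE// ?mulr_ge0 ?(ltW c0)//.
  by rewrite exprMn [c ^+ 2]expr2 cc; lra.
have arg : s * (4 * Num.sqrt 2 ^+ n - 3) <= c * (s * (4 * Num.sqrt 2 ^+ n.+1 - 3) - s).
  have -> : c * (s * (4 * Num.sqrt 2 ^+ n.+1 - 3) - s) =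
      s * (4 * Num.sqrt 2 ^+ n - 4 * c).
    by rewrite exprS sq2; field; rewrite gt_eqF.
  by apply: ler_wpM2l => //; lra.
have h1 : 0 <= 1 - mass (c * (s * (4 * Num.sqrt 2 ^+ n.+1 - 3) - s)).
  by rewrite subr_ge0 mass_le1.
have h2 : 1 - mass (c * (s * (4 * Num.sqrt 2 ^+ n.+1 - 3) - s)) <=
    mass s * expR (- (2 * 2 ^+ n)).
  by apply: le_trans IH; rewrite lerD2l lerN2 le_mass.
have m0 : 0 < mass s by apply: lt_le_trans ms; lra.
rewrite -(ler_pM2l m0); apply: le_trans step _.
apply: (@le_trans _ _ ((mass s * expR (- (2 * 2 ^+ n))) ^+ 2)).
  by rewrite lerXn2r// nnegrE// (le_trans h1 h2).
rewrite exprMn expr2 -expRM_natl -mulrA [2 ^+ n.+1]exprS.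
by rewrite (_ : 2%:R * - (2 * 2 ^+ n) = - (2 * (2 * 2 ^+ n)) :> R)//; ring.
Qed.

End Fernique.

(** * Gaussian tails and exponential tightness *)

Definition symmetrization (T : Type) (V : zmodType) (X : T -> V) (w : T * T) : V :=
  X w.1 - X w.2.

Section GaussianTail.
Context {R : realType} {E : normedModType R}.
Context (d : measure_display) (Omega : measurableType d) (P : probability Omega R).
Context (X : Omega -> E).
Hypothesis gX : forall h, dual h -> real_gaussian P (fun w => h (X w)).

Local Notation U := (symmetrization X).

Lemma centered_symmetrization : centered_gaussian (P \x P)%E U.
Proof.
move=> h dh; have mh : measurable_fun setT (fun w => h (X w)) := (gX dh).1.
have UE w : h (U w) = h (X w.1) - h (X w.2) by rewrite /symmetrization (dualB _ _ dh).
split.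
  rewrite (_ : h \o U = fun w => h (X w.1) - h (X w.2)); last first.
    by apply/funext => w; rewrite /= UE.
  apply: measurable_funB; first exact: (measurableT_comp mh measurable_fst).
  exact: (measurableT_comp mh measurable_snd).
have [m [s ms]] := real_gaussian_mgf (gX dh).
exists (s ^+ 2) => t.
under eq_integral do rewrite UE mulrBr expRD -mulNr.
have me u : measurable_fun setT (fun w => expR (u * h (X w))).
  by apply: measurableT_comp => //; exact: measurable_funM.
rewrite (@integral_prodM _ _ _ _ _ P P (fun w => expR (t * h (X w)))
  (fun w => expR (- t * h (X w))))//; try by move=> w; exact: expR_ge0.
by rewrite !ms -EFinM -expRD; congr (expR _)%:E; field.
Qed.

Context (f : nat -> E -> R).
Hypothesis df : forall k, dual (f k).
Hypothesis f1 : 39 / 40 <= mass P X f 1.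

(** If X leaves the polar set of radius t + 1 while an independent copy stays in the
    one of radius 1, then their difference leaves the one of radius t.  The factor 2
    in the exponent of [fernique] absorbs the constants. *)
Lemma gaussian_tail (n : nat) :
  (P (X @^-1` ~` polar f (8 * Num.sqrt 2 ^+ n)) <= (expR (- 2 ^+ n))%:E)%E.
Proof.
have mX k : measurable_fun setT (f k \o X) := (gX (df k)).1.
have cU := centered_symmetrization; have mU k : measurable_fun setT (f k \o U) := (cU _ (df k)).1.
have fB k w : f k (U w) = f k (X w.1) - f k (X w.2) by rewrite /symmetrization (dualB _ _ (df k)).
have [tau tauE] : exists tau : R, tau = 2 * (4 * Num.sqrt 2 ^+ n - 3) by eexists.
have sq1 : 1 <= Num.sqrt 2 ^+ n :> R.
  by apply: exprn_ege1; rewrite -{1}sqrtr1 ler_sqrt// ler1n.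
have [m2 [mt [F m2le step]]] : exists m2 mt : R,
    [/\ 1 - mt <= m2 * expR (- (2 * 2 ^+ n)), m2 <= 1 &
       (1 - mass P X f (tau + 1)) * mass P X f 1 <= 1 - mt].
  exists (mass (P \x P)%E U f 2), (mass (P \x P)%E U f tau).
  have mass2 : 19 / 20 <= mass (P \x P)%E U f 2.
    apply: (@le_trans _ _ (mass P X f 1 * mass P X f 1)); first by
      apply: (@le_trans _ _ (39 / 40 * (39 / 40))); [lra|apply: ler_pM => //; lra].
    rewrite -lee_fin -massE// EFinM -!massE// -product_measure1E//;
      [|exact: measurable_polar|exact: measurable_polar].
    apply: le_measure; rewrite ?inE.
    - by apply: measurableX; exact: measurable_polar.
    - exact: measurable_polar.
    move=> w [/= h1 h2] k; rewrite fB; apply: le_trans (ler_normB _ _) _.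
    by have := h1 k; have := h2 k; lra.
  split; [by rewrite tauE; apply: (fernique cU df)|exact: mass_le1|].
  rewrite -lee_fin -massC// EFinM -massC// -massE// -product_measure1E//; last 2 first.
  - by rewrite -preimage_setC; apply: measurableC; exact: measurable_polar.
  - exact: measurable_polar.
  apply: le_measure; rewrite ?inE.
  - apply: measurableX; last exact: measurable_polar.
    by rewrite -preimage_setC; apply: measurableC; exact: measurable_polar.
  - by rewrite -preimage_setC; apply: measurableC; exact: measurable_polar.
  move=> w [/= h1 h2] h; apply: h1 => k.
  have := h k; have := h2 k; rewrite fB => a b.
  rewrite -(subrK (f k (X w.2)) (f k (X w.1))); apply: le_trans (ler_normD _ _) _.
  exact: lerD.
have mono : mass P X f (tau + 1) <= mass P X f (8 * Num.sqrt 2 ^+ n).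
  by apply: le_mass => //; lra.
rewrite massC// lee_fin.
have e0 := expR_gt0 (- 2 ^+ n : R).
have e2 : expR (- (2 * 2 ^+ n)) = expR (- 2 ^+ n) * expR (- 2 ^+ n) :> R.
  by rewrite -expRD; congr expR; ring.
have e1 : expR (- 2 ^+ n) <= 2^-1 :> R.
  rewrite expRN lef_pV2 ?posrE ?expR_gt0//.
  apply: le_trans (expR_ge1Dx _); have : 1 <= 2 ^+ n :> R by rewrite exprn_ege1// ler1n.
  lra.
have e2' : expR (- (2 * 2 ^+ n)) <= 2^-1 * expR (- 2 ^+ n) :> R.
  by rewrite e2 ler_pM2r.
have h3 : m2 * expR (- (2 * 2 ^+ n)) <= 2^-1 * expR (- 2 ^+ n).
  apply: le_trans e2'; rewrite ler_piMl// expR_ge0.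
have h4 := mass_le1 P mX (tau + 1).
have : (1 - mass P X f (tau + 1)) * (39 / 40) <= 2^-1 * expR (- 2 ^+ n).
  apply: le_trans h3; apply: le_trans F; apply: le_trans step.
  by apply: ler_wpM2l => //; lra.
lra.
Qed.

(** Between consecutive powers of 2: with the least [n] such that g r <= 2 ^ n, the
    radius of [gaussian_tail] is at most a fixed multiple of sqrt g.  The lower
    bound [g0] is needed when this [n] is 0. *)
Lemma gaussian_tail_speed (g0 r : R) : 0 < g0 -> 0 < r ->
  forall g : R, g0 <= g ->
    (P (X @^-1` ~` polar f (8 * Num.sqrt (Num.max g0^-1 (2 * r)) * Num.sqrt g)%R) <=
     (expR (- (g * r)))%:E)%E.
Proof.
move=> g00 r0 g gg; have g_gt0 : 0 < g := lt_le_trans g00 gg.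
set M := Num.max _ _.
have [n /andP[n1 n2]] : exists n : nat, g * r <= 2 ^+ n <= g * M.
  have ex : exists n : nat, g * r <= 2 ^+ n.
    exists (Num.truncn (g * r)).
    apply: le_trans (ltW (truncnS_gt _)) _.
    by rewrite -natrX ler_nat ltn_expl.
  case: (ex_minnP ex) => n n1 nmin; exists n; rewrite n1 /=.
  case: n n1 nmin => [|n] n1 nmin.
    rewrite expr0; apply: (@le_trans _ _ (g * g0^-1)).
      by rewrite ler_pdivlMr// mul1r.
    by rewrite ler_pM2l// le_max lexx.
  apply: (@le_trans _ _ (g * (2 * r))); last by rewrite ler_pM2l// le_max lexx orbT.
  rewrite exprS mulrCA ler_pM2l//.
  have : ~~ (g * r <= 2 ^+ n) by apply/negP => /nmin; rewrite ltnn.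
  by rewrite -ltNge => /ltW.
apply: (@le_trans _ _ (expR (- 2 ^+ n))%:E); last by rewrite lee_fin ler_expR lerN2.
apply: le_trans (gaussian_tail n).
have mX k : measurable_fun setT (f k \o X) := (gX (df k)).1.
rewrite !massC// lee_fin lerD2l lerN2; apply: le_mass => //.
rewrite -mulrA ler_pM2l// -sqrtrM.
  have -> : Num.sqrt 2 ^+ n = Num.sqrt (2 ^+ n) :> R.
    by rewrite -[LHS]ger0_norm ?exprn_ge0// -sqrtr_sqr -exprM mulnC exprM sqr_sqrtr.
  by rewrite mulrC; exact: ler_wsqrtr.
by rewrite /M le_max invr_ge0 ltW.
Qed.

End GaussianTail.

Lemma speed_function_lb (R : realType) (g : nat -> R) : speed_function g ->
  exists2 g0, 0 < g0 & forall n, g0 <= g n.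
Proof.
move=> [g_gt0 /cvgryPge/(_ 1)[N _ gN]].
pose m := \big[Num.min/1]_(i < N) g i.
exists m; first by rewrite /m; elim/big_ind: _ => // x y x0 y0; rewrite lt_min x0.
move=> n; have [nN|Nn] := ltnP n N.
  exact: (bigmin_le_cond _ (j := Ordinal nN)).
by apply: (@le_trans _ _ 1); [exact: bigmin_le_id|exact: gN].
Qed.

Unset Implicit Arguments.

Theorem theorem2p3 (R : realType) (E : completeNormedModType R)
    (sepE : separable E) (d : measure_display) (Omega : measurableType d)
    (P : probability Omega R) :
  (forall (A : Type) (X : A -> {RV P >-> borel E}),
     (forall a, gaussian (X a)) ->
     tight P (fun a w => X a w : E) ->
     forall g : nat -> R, speed_function g ->
       uniformly_exponentially_tight P g
         (fun a n w => g n `^ (- (1 / 2)) *: (X a w : E)))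
  /\
  (forall X : nat -> {RV P >-> borel E},
     (forall n, gaussian (X n)) ->
     tight P (fun n w => X n w : E) ->
     forall g : nat -> R, speed_function g ->
       exponentially_tight P g
         (fun n w => g n `^ (- (1 / 2)) *: (X n w : E))).
Proof.
(* The second part is the diagonal case of the first one, at rate r + 1 in order to
   have a strict inequality. *)
have main (A : Type) (X : A -> {RV P >-> borel E}) :
     (forall a, gaussian (X a)) ->
     tight P (fun a w => X a w : E) ->
     forall g : nat -> R, speed_function g ->
       uniformly_exponentially_tight P g
         (fun a n w => g n `^ (- (1 / 2)) *: (X a w : E)).
  move=> gX tX g sg r r0.
  have [g0 g00 g0g] := speed_function_lb sg.
  have [K cK PK] := tX (1 / 40) ltac:(lra).
  have [th [cth thK cpol]] := compact_polar sepE cK.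
  pose f k (x : E) : R := th k x.
  have df k : dual (f k) by exists (th k).
  have gaussX a h : dual h -> real_gaussian P (fun w => h (X a w : E)).
    by move=> [u cu ->]; exact: gX.
  have mX a k : measurable_fun setT (f k \o (X a : Omega -> E)) := (gaussX a _ (df k)).1.
  have mass1 a : 39 / 40 <= mass P (X a : Omega -> E) f 1.
    suff : 1 - mass P (X a : Omega -> E) f 1 <= 1 / 40 by lra.
    rewrite -lee_fin -massC//; apply: le_trans (ltW (PK a)).
    have mK : measurable ((X a : Omega -> borel E) @^-1` ~` K).
      rewrite -[X in measurable X]setTI; apply: measurable_funP => //.
      apply: sub_sigma_algebra; apply: closed_openC.
      by apply: compact_closed => //; exact: norm_hausdorff.
    apply: le_measure; rewrite ?inE//.
      by rewrite -preimage_setC; apply: measurableC; exact: measurable_polar.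
    by move=> w /= h Kw; apply: h => k; exact: thK.
  set t := 8 * Num.sqrt (Num.max g0^-1 (2 * r)).
  exists (polar f t); first exact: cpol.
  move=> a n.
  have gn0 : 0 < g n := lt_le_trans g00 (g0g n).
  apply: le_trans (gaussian_tail_speed (gaussX a) df (mass1 a) g00 r0 (g0g n)).
  rewrite le_eqVlt; apply/orP; left; apply/eqP; congr (P _).
  have -> : g n `^ (- (1 / 2)) = (Num.sqrt (g n))^-1.
    by rewrite powRN div1r powR12_sqrt// ltW.
  apply/seteqP; split=> w /= h hk; apply: h => k; have := hk k;
    rewrite /f linearZ /= normrM ger0_norm ?invr_ge0 ?sqrtr_ge0//;
    by rewrite ler_pdivrMl ?sqrtr_gt0// mulrC.
split=> [|X gX tX g sg r r0]; first exact: main.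
have [K cK PK] := main nat X gX tX g sg (r + 1) ltac:(lra).
exists K => // n; apply: le_lt_trans (PK n n) _; rewrite lte_fin ltr_expR ltrN2.
by rewrite ltr_pM2l ?ltrDl//; have [] := sg.
Qed.
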